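(* Let $I$ be a finite index set, let $(P_n)_{n\in\mathbb N}$ and $(Q_n)_{n\in\mathbb N}$ be approximately geometric sequences (in the semiring of $I$-indexed families of measures with full support, with the majorization preorder) of $I$-indexed families of probability distributions, and let $U$ be a power universal element. Then the multivariate R\'enyi divergence rates \[\overline D_{\underline\alpha}(P):=\lim_{n\to\infty}\frac1nD_{\underline\alpha}(P_n)\] exist (similarly defined for $Q$, and including the pointwise limits of the functionals $D_{\underline\alpha}$), and the following are equivalent: (i) there is a sublinear sequence $(k_n)_{n\in\mathbb N}$ such that $U^{\otimes k_n}\otimes P_n\ge Q_n$ for all $n\in\mathbb N$; (ii) $\overline D_{\underline\alpha}(P)\ge\overline D_{\underline\alpha}(Q)$ for all admissible $\underline\alpha$ (including the pointwise limits).
   Context: Majorization semiring: elements are equivalence classes of families $P=(P_i)_{i\in I}$ of measures on a finite set $\mathcal X$ (which varies with the element) with full support, i.e. $P_i(x)>0$ for all $x\in\mathcal X$, $i\in I$; families on $\mathcal X$ and $\mathcal X'$ are equivalent if related by a bijection $\mathcal X\to\mathcal X'$. A family is viewed as a matrix with columns $P_i$. Addition is columnwise direct sum (measures on $\mathcal X\sqcup\mathcal X'$), multiplication $\otimes$ is columnwise Kronecker product (product measures on $\mathcal X\times\mathcal X'$); zero is the family on $\mathcal X=\emptyset$ and the unit is $(1,\dots,1)$ on a singleton. Majorization: $P\ge P'$ iff there is a column-stochastic matrix $T$ with $P'=TP$ (i.e. $P'_i=TP_i$ for all $i\in I$). This is a preordered semiring. An element $U$ is power universal if it is nonzero, $1\le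 U$, and for all nonzero $X\le Y$ there is $k\in\mathbb N$ with $Y\le U^{\otimes k}\otimes X$; in this semiring these are exactly the families of probability measures ($\|U_i\|_1=1$ for all $i$) with $U_i\ne U_{i'}$ for $i\ne i'$. $\mathbb N$ includes $0$; a sublinear sequence is a sequence $(k_n)_{n\in\mathbb N}$ in $\mathbb N$ with $k_n/n\to0$. A sequence $(P_n)_{n\in\mathbb N}$ of nonzero elements is approximately geometric if there is a sublinear sequence $(k_n)$ such that for all $t\in\mathbb N_{>0}$ and $n_1,\dots,n_t\in\mathbb N$ both $P_{n_1}\otimes\cdots\otimes P_{n_t}\le U^{\otimes(k_{n_1}+\dots+k_{n_t})}\otimes P_{n_1+\dots+n_t}$ and $P_{n_1+\dots+n_t}\le U^{\otimes(k_{n_1}+\dots+k_{n_t})}\otimes P_{n_1}\otimes\cdots\otimes P_{n_t}$ hold (independent of the choice of power universal $U$). Multivariate R\'enyi divergences: a tuple $\underline\alpha=(\alpha_i)_{i\in I}$ of reals is admissible if $\sum_{i\in I}\alpha_i=1$ and either $0\le\alpha_i<1$ for all $i\in I$, or there is $i\in I$ with $\alpha_i>1$ and $\alpha_{i'}\le0$ for all $i'\in I\setminus\{i\}$. For admissible $\underline\alpha$, \[D_{\underline\alpha}(P)=\frac{1}{\max_{i\in I}\alpha_i-1}\log_2\sum_{x\in\mathcal X}\prod_{i\in I}P_i(x)^{\alpha_i}.\] The pointwise limits are the functionals $D$ obtained as $D(P)=\lim_kD_{\underline\alpha^{(k)}}(P)$ (limit existing for every full-support family $P$ of probability distributions) along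 sequences $(\underline\alpha^{(k)})_k$ of admissible tuples; their rates are $\lim_n\frac1nD(P_n)$. *)

(* Defs.v *)
From HB Require Import structures.
From mathcomp Require Import all_boot all_order all_algebra.
From mathcomp Require Import all_classical all_reals all_analysis.

Set Implicit Arguments.
Unset Strict Implicit.
Unset Printing Implicit Defensive.
Import Order.TTheory GRing.Theory Num.Theory.
Import numFieldNormedType.Exports.
Local Open Scope classical_set_scope.
Local Open Scope ring_scope.

(* The majorization semiring consists of families of full-support measures    *)
(* modulo bijections of the underlying finite set.  We work throughout with   *)
(* representatives: [mfamily R I] is the type of representatives, [fequiv] is *)
(* equality in the semiring, and the lemmas [majorizes_fequiv],               *)
(* [fequiv_tensor] and [renyi_fequiv] record that the notions below are       *)
(* compatible with it.                                                        *)
Record mfamily (R : realType) (I : finType) := MFamily {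
  carrier : finType;
  mass : I -> carrier -> R;
  mass_gt0 : forall i x, 0 < mass i x
}.

Section Semiring.
Variables (R : realType) (I : finType).
Implicit Types P Q U : mfamily R I.

Definition fequiv P Q : Prop :=
  exists f : carrier P -> carrier Q,
    bijective f /\ forall i x, mass i (f x) = mass i x.

Definition fzero : mfamily R I :=
  @MFamily R I void (fun _ x => match x with end)
                   (fun _ x => match x with end).

Definition fone : mfamily R I :=
  @MFamily R I unit (fun _ _ => 1) (fun _ _ => ltr01).

Definition tensor P Q : mfamily R I :=
  @MFamily R I (carrier P * carrier Q)%type
    (fun i xy => mass i xy.1 * mass i xy.2)
    (fun i xy => mulr_gt0 (mass_gt0 i xy.1) (mass_gt0 i xy.2)).

Definition tensor_exp U (k : nat) : mfamily R I := iter k (tensor U) fone.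

(* [T y x] is the entry of [T] in row [y] and column [x]. *)
Definition column_stochastic (X Y : finType) (T : Y -> X -> R) : Prop :=
  (forall y x, 0 <= T y x) /\ (forall x, \sum_(y : Y) T y x = 1).

(* [majorizes P Q] is P >= Q. *)
Definition majorizes P Q : Prop :=
  exists T : carrier Q -> carrier P -> R,
    column_stochastic T /\
    forall i y, mass i y = \sum_(x : carrier P) T y x * mass i x.

Definition fnonzero P : Prop := ~ fequiv P fzero.

Definition is_probability P : Prop :=
  forall i, \sum_(x : carrier P) mass i x = 1.

Definition power_universal U : Prop :=
  [/\ fnonzero U, majorizes U fone &
      forall P Q, fnonzero P -> fnonzero Q -> majorizes Q P ->
        exists k : nat, majorizes (tensor (tensor_exp U k) P) Q].

Definition sublinear (k : nat -> nat) : Prop :=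
  (fun n : nat => (k n)%:R / n%:R : R) @ \oo --> (0 : R).

Definition approx_geometric U (P : nat -> mfamily R I) : Prop :=
  (forall n, fnonzero (P n)) /\
  exists k : nat -> nat, sublinear k /\
    forall (t : nat) (n : 'I_t -> nat), (0 < t)%N ->
      majorizes
        (tensor (tensor_exp U (\sum_(j < t) k (n j))%N)
                (P (\sum_(j < t) n j)%N))
        (\big[tensor/fone]_(j < t) P (n j)) /\
      majorizes
        (tensor (tensor_exp U (\sum_(j < t) k (n j))%N)
                (\big[tensor/fone]_(j < t) P (n j)))
        (P (\sum_(j < t) n j)%N).

Definition admissible (alpha : I -> R) : Prop :=
  \sum_(i : I) alpha i = 1 /\
  ((forall i, 0 <= alpha i < 1) \/
   (exists i, 1 < alpha i /\ forall i', i' != i -> alpha i' <= 0)).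

(* The default value 0 of the iterated maximum is harmless: the entries of an *)
(* admissible tuple sum to 1, so one of them is positive.                     *)
Definition renyi (alpha : I -> R) P : R :=
  (\big[Num.max/0]_(i : I) alpha i - 1)^-1 *
  (ln (\sum_(x : carrier P) \prod_(i : I) (mass i x) `^ (alpha i)) / ln 2).

(* Only the values of [D] on probability families are constrained. *)
Definition renyi_limit (D : mfamily R I -> R) : Prop :=
  exists alpha : nat -> I -> R,
    (forall k, admissible (alpha k)) /\
    forall P, is_probability P -> (fun k => renyi (alpha k) P) @ \oo --> D P.

Definition rate_seq (D : mfamily R I -> R) (P : nat -> mfamily R I) : nat -> R :=
  fun n => n%:R^-1 * D (P n).

Definition rate (D : mfamily R I -> R) (P : nat -> mfamily R I) : R :=
  limn (rate_seq D P).

Lemma fnonzeroP P : fnonzero P <-> (0 < #|carrier P|)%N.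
Proof.
split=> [nz|/card_gt0P[x _] [f _]]; last by case: (f x).
rewrite lt0n; apply/eqP => P0; apply: nz.
have e (x : carrier P) : False by have := card0_eq P0 x; rewrite inE.
exists (fun x => match e x with end); split; last by move=> i x; case: (e x).
by exists (fun v : void => match v with end) => x; [case: (e x)|case: x].
Qed.

Lemma fequiv_sym P Q : fequiv P Q -> fequiv Q P.
Proof.
move=> [f [[g fK gK] fP]]; exists g; split; first by exists f.
by move=> i y; rewrite -{2}(gK y) fP.
Qed.

Lemma majorizes_trans P Q U : majorizes P Q -> majorizes Q U -> majorizes P U.
Proof.
move=> [S [[S0 S1] SE]] [T [[T0 T1] TE]].
exists (fun z x => \sum_y T z y * S y x); split; first split.
- by move=> z x; apply: sumr_ge0 => y _; rewrite mulr_ge0.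
- move=> x; rewrite exchange_big /= -(S1 x); apply: eq_bigr => y _.
  by rewrite -mulr_suml T1 mul1r.
- move=> i z; rewrite TE.
  under eq_bigr => y _ do rewrite SE mulr_sumr.
  rewrite exchange_big /=; apply: eq_bigr => x _.
  by rewrite mulr_suml; apply: eq_bigr => y _; rewrite mulrA.
Qed.

Lemma fequiv_majorizes P Q : fequiv P Q -> majorizes P Q.
Proof.
move=> [f [[g fK gK] fP]]; exists (fun y x => (y == f x)%:R); split; first split.
- by move=> y x; rewrite ler0n.
- by move=> x; rewrite (bigD1 (f x)) //= eqxx big1 ?addr0 // => y /negbTE ->.
- move=> i y; rewrite (bigD1 (g y)) //= gK eqxx mul1r big1 ?addr0.
    by rewrite -{1}(gK y) fP.
  move=> x xy; case: eqP => [yE|]; last by rewrite mul0r.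
  by rewrite yE fK eqxx in xy.
Qed.

Lemma majorizes_fequiv P P' Q Q' :
  fequiv P P' -> fequiv Q Q' -> majorizes P Q <-> majorizes P' Q'.
Proof.
move=> PP QQ; split=> PQ.
- apply: majorizes_trans (fequiv_majorizes QQ).
  exact: majorizes_trans (fequiv_majorizes (fequiv_sym PP)) PQ.
- apply: majorizes_trans (fequiv_majorizes (fequiv_sym QQ)).
  exact: majorizes_trans (fequiv_majorizes PP) PQ.
Qed.

Lemma fequiv_tensor P P' Q Q' :
  fequiv P P' -> fequiv Q Q' -> fequiv (tensor P Q) (tensor P' Q').
Proof.
move=> [f [[f' fK f'K] fP]] [g [[g' gK g'K] gP]].
exists (fun xy => (f xy.1, g xy.2)); split.
  by exists (fun xy => (f' xy.1, g' xy.2)) => -[x y] /=;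
    rewrite ?fK ?gK ?f'K ?g'K.
by move=> i [x y] /=; rewrite fP gP.
Qed.

Lemma renyi_fequiv alpha P Q : fequiv P Q -> renyi alpha P = renyi alpha Q.
Proof.
move=> [f [fB fP]]; rewrite /renyi; congr (_ * (ln _ / _)).
rewrite [RHS](reindex f) /=; last exact: onW_bij.
by apply: eq_bigr => x _; apply: eq_bigr => i _; rewrite fP.
Qed.

End Semiring.

(* Main.v *)
(* The asymptotic majorization U^(o(n)) (x) P_n >= Q_n is obtained from the
   divergence inequalities by large deviations.

   Quasi-additivity of approximately geometric sequences turns the rate
   inequalities into D_alpha(A) >= D_alpha(B) for single families A (P_m times
   a sublinear power of U) and B = Q_m; it then suffices that
   U^N (x) A^N >= B^N for large N, since this costs O((1 + k_m) / m) copies of U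
   per unit of n.

   Group the rows of A^N and B^N by empirical type: the type t has row
   exp(- N kl(t, A_i)) up to a common factor, and there are polynomially many
   types. By convex duality the divergence inequalities say exactly that
   - every type t of A has a type s of B with kl(s, B_i) <= kl(t, A_i) for all i
     (all alpha_i >= 0), so the mass of t can be sent to s without overshooting;
   - every type s of B and hypothesis g have a type t of A with
     kl(t, A_g) <= kl(s, B_g) and
     kl(t, A_i) - kl(t, A_g) >= kl(s, B_i) - kl(s, B_g) (alpha_g > 1, the other
     alpha_i <= 0), so t can supply s under g without overshooting under i.
   The factor U^N identifies the hypothesis up to an exponentially small error,
   so the supplies for different hypotheses interact weakly, and a diagonally
   dominant linear system corrects the output of the channel to be exactly B^N. *)

Require Import Defs.
From HB Require Import structures.
From mathcomp Require Import all_boot all_order all_algebra.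
From mathcomp Require Import all_classical all_reals all_analysis.
From mathcomp Require Import ring lra zify.
Import Order.TTheory GRing.Theory Num.Theory.
Import numFieldNormedType.Exports.
Local Open Scope classical_set_scope.
Local Open Scope ring_scope.

Set Implicit Arguments.
Unset Strict Implicit.

(** * Tensor powers *)

(** Majorization demands equality in every row under every hypothesis, so the channel has to be
    accurate relative to each row of the target, however improbable that row is, and not merely in
    total variation. This is why atypical rows get suppliers of their own and why an approximate
    channel must be corrected afterwards. The output is affine in a perturbation of the supplies, so
    the correction is a linear problem whose unknown is a small relative change. The divergence
    inequalities are not strict, so each approximation (slack in the duality, mixing, rounding to
    types) may lose some exponent. These losses total at most c / 4, whereas a wrong guess has
    exponent c, obtained from the Bhattacharyya coefficients of [U]. Mixing in the hypothesis with
    weight th provides the strict gain that makes atypical rows negligible. On the asymptotic side,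
    a rate determines D at level m up to k_m D(U), which is D of the k_m-th power of [U]. One power
    of [U] thus absorbs the error for all divergences at once, with no uniformity in alpha to
    establish. *)

Section Majorization.
Variables (R : realType) (I : finType).
Implicit Types P Q S U : mfamily R I.

Lemma majorizes_refl P : majorizes P P.
Proof.
by apply: fequiv_majorizes; exists id; split => //; exists id.
Qed.

Lemma majorizes_tensor P P' Q Q' : majorizes P P' -> majorizes Q Q' ->
  majorizes (tensor P Q) (tensor P' Q').
Proof.
move=> [S [[S0 S1] SE]] [T [[T0 T1] TE]].
exists (fun y x => S y.1 x.1 * T y.2 x.2); split; first split.
- by move=> y x; rewrite mulr_ge0.
- move=> [x x'] /=; rewrite -(pair_bigA _ (fun y y' => S y x * T y' x')) /=.
  rewrite -(S1 x); apply: eq_bigr => y _.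
  by rewrite -mulr_sumr T1 mulr1.
- move=> i [y y'] /=; rewrite SE TE mulr_suml.
  rewrite -(pair_bigA _ (fun x x' => S y x * T y' x' * (mass i x * mass i x'))) /=.
  apply: eq_bigr => x _; rewrite mulr_sumr; apply: eq_bigr => x' _; ring.
Qed.

Lemma tensor_assoc P Q S : fequiv (tensor (tensor P Q) S) (tensor P (tensor Q S)).
Proof.
exists (fun x => (x.1.1, (x.1.2, x.2))); split.
  by exists (fun x => ((x.1, x.2.1), x.2.2)) => [[[x y] z]|[x [y z]]].
by move=> i [[x y] z] /=; rewrite mulrA.
Qed.

Lemma tensor_comm P Q : fequiv (tensor P Q) (tensor Q P).
Proof.
exists (fun x => (x.2, x.1)); split; first by exists (fun x => (x.2, x.1)) => -[].
by move=> i [x y] /=; rewrite mulrC.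
Qed.

Lemma tensor1 P : fequiv (tensor P (fone R I)) P.
Proof.
exists (fun x => x.1); split; first by exists (fun x => (x, tt)) => // -[x []].
by move=> i [x []] /=; rewrite mulr1.
Qed.

Lemma fequiv_refl P : fequiv P P.
Proof. by exists id; split => //; exists id. Qed.

Lemma fequiv_trans P Q S : fequiv P Q -> fequiv Q S -> fequiv P S.
Proof.
move=> [f [fb fP]] [g [gb gP]]; exists (g \o f); split; first exact: bij_comp.
by move=> i x /=; rewrite gP fP.
Qed.

Lemma tensor1l P : fequiv (tensor (fone R I) P) P.
Proof. exact: fequiv_trans (tensor_comm _ _) (tensor1 P). Qed.

Lemma tensorACA P Q S U : fequiv (tensor (tensor P Q) (tensor S U))
  (tensor (tensor P S) (tensor Q U)).
Proof.
exists (fun x => ((x.1.1, x.2.1), (x.1.2, x.2.2))); split.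
  by exists (fun x => ((x.1.1, x.2.1), (x.1.2, x.2.2))) => [[[x y] [z t]]|[[x y] [z t]]].
by move=> i [[x y] [z t]] /=; rewrite mulrACA.
Qed.

Lemma tensor_expD U j k :
  fequiv (tensor_exp U (j + k)) (tensor (tensor_exp U j) (tensor_exp U k)).
Proof.
elim: j => [|j IH]; first exact: fequiv_sym (tensor1l _).
rewrite addSn /=; apply: fequiv_trans (fequiv_sym (tensor_assoc _ _ _)).
exact: fequiv_tensor (fequiv_refl U) IH.
Qed.

Lemma tensor_exp_tensor P Q k : fequiv (tensor_exp (tensor P Q) k)
  (tensor (tensor_exp P k) (tensor_exp Q k)).
Proof.
elim: k => [|k IH]; first exact: fequiv_sym (tensor1 _).
apply: fequiv_trans (tensorACA _ _ _ _).
exact: fequiv_tensor (fequiv_refl _) IH.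
Qed.

Lemma tensor_expM U j k : fequiv (tensor_exp (tensor_exp U j) k) (tensor_exp U (k * j)).
Proof.
elim: k => [|k IH]; first exact: fequiv_refl.
rewrite mulSn; apply: fequiv_trans (fequiv_sym (tensor_expD _ _ _)).
exact: fequiv_tensor (fequiv_refl _) IH.
Qed.

Lemma tensor_probability P Q : is_probability P -> is_probability Q ->
  is_probability (tensor P Q).
Proof.
move=> P1 Q1 i /=; rewrite -(pair_bigA _ (fun x y => mass i x * mass i y)) /=.
by rewrite -(P1 i); apply: eq_bigr => x _; rewrite -mulr_sumr Q1 mulr1.
Qed.

Lemma fone_probability : is_probability (fone R I).
Proof. by move=> i; rewrite sumr_const card_unit. Qed.

Lemma tensor_exp_probability U k : is_probability U ->
  is_probability (tensor_exp U k).
Proof.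
move=> U1; elim: k => [|k IH]; first exact: fone_probability.
exact: tensor_probability.
Qed.

Lemma majorizes_fone P : is_probability P <-> majorizes P (fone R I).
Proof.
split=> [P1|[T [[_ T1] TE]] i].
  exists (fun _ _ => 1); split; first split => //.
    by move=> x; rewrite sumr_const card_unit.
  by move=> i y; rewrite -[LHS](P1 i); apply: eq_bigr => x _; rewrite mul1r.
have := TE i tt; rewrite /= => ->; apply: eq_bigr => x _.
have := T1 x; rewrite (big_pred1 tt) => [->|[]]; rewrite ?mul1r //.
Qed.

Lemma fone_nonzero : fnonzero (fone R I).
Proof. by apply/fnonzeroP; rewrite card_unit. Qed.

End Majorization.

(** * Exact channels *)

(** The equation at an index where [|e z|] is maximal bounds the whole solution. For [b = 0] this
    bound gives injectivity, hence invertibility of the square matrix. Dominance is stated for the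
    action on vectors because the operator it serves is not given by its entries. *)
Lemma dominant_solve {R : realType} {Z : finType} (M : Z -> Z -> R) (d : Z -> R)
    (c d0 : R) : c < d0 -> (forall z, d0 <= d z) ->
  (forall (e : Z -> R) B z, (forall z', `|e z'| <= B) ->
     `|\sum_z' M z z' * e z' - d z * e z| <= c * B) ->
  forall (b : Z -> R) B0, (forall z, `|b z| <= B0) ->
  exists e : Z -> R, (forall z, \sum_z' M z z' * e z' = b z) /\
    forall z, `|e z| * (d0 - c) <= B0.
Proof.
move=> cd dd dom.
have bound (e b : Z -> R) B0 : (forall z, `|b z| <= B0) ->
    (forall z, \sum_z' M z z' * e z' = b z) ->
    forall z, `|e z| * (d0 - c) <= B0.
  move=> bB eb z.
  have [m _ mP] := @Order.TotalTheory.arg_maxP _ _ _ z xpredT (fun z => `|e z|) isT.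
  have := dom e `|e m| m (fun z' => mP z' isT).
  rewrite eb => h.
  have h1 : `|d m * e m| <= B0 + c * `|e m|.
    rewrite -[d m * e m](subrK (b m)) addrC.
    apply: le_trans (ler_normD _ _) _; rewrite lerD // distrC //.
  have h2 : d0 * `|e m| <= `|d m * e m|.
    by rewrite normrM ler_wpM2r // (le_trans (dd m)) // ler_norm.
  have h3 : `|e m| * (d0 - c) <= B0 by lra.
  apply: le_trans h3; rewrite ler_wpM2r ?subr_ge0 ?(ltW cd) //; exact: mP.
move=> b B0 bB.
pose A : 'M[R]_#|Z| := \matrix_(i, j) M (enum_val j) (enum_val i).
have AE (v : 'rV[R]_#|Z|) z :
    (v *m A) 0 (enum_rank z) = \sum_z' M z z' * v 0 (enum_rank z').
  rewrite mxE (reindex enum_rank) /=; last exact/onW_bij/enum_rank_bij.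
  by apply: eq_bigr => z' _; rewrite mxE !enum_rankK mulrC.
have Au : A \in unitmx.
  rewrite -row_free_unit -kermx_eq0; apply/rowV0P => v /sub_kermxP vA.
  have v0 := bound (fun z => v 0 (enum_rank z)) (fun=> 0) 0.
  apply/rowP => i; rewrite mxE; apply/eqP; rewrite -normr_le0.
  have := v0 _ _ (enum_val i); rewrite enum_valK pmulr_lle0 ?subr_gt0 //; apply.
    by move=> z; rewrite normr0.
  by move=> z; rewrite -AE vA mxE.
pose v : 'rV[R]_#|Z| := (\row_j b (enum_val j)) *m invmx A.
have vb z : \sum_z' M z z' * v 0 (enum_rank z') = b z.
  by rewrite -AE /v mulmxKV // mxE enum_rankK.
exists (fun z => v 0 (enum_rank z)); split => //.
exact: bound bB vb.
Qed.

(** Expanding [e] in indicator functions produces the matrix of [F], the form that [dominant_solve]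
    expects. *)
Lemma linear_kernel {R : realType} {Z : finType} (F : (Z -> R) -> Z -> R) :
  (forall a u v z, F (fun z => a * u z + v z) z = a * F u z + F v z) ->
  forall e z, \sum_z' F (fun y => (y == z')%:R) z * e z' = F e z.
Proof.
move=> Flin e z.
have F0 : F (fun=> 0) z = 0.
  have := Flin (-1) (fun=> 0) (fun=> 0) z.
  rewrite (_ : (fun _ : Z => -1 * 0 + 0) = (fun=> 0)); last first.
    by apply/funext => y; rewrite mulr0 addr0.
  by move=> ->; rewrite mulN1r addNr.
have Fs (s : seq Z) : F (fun y => \sum_(z' <- s) e z' * (y == z')%:R) z =
    \sum_(z' <- s) e z' * F (fun y => (y == z')%:R) z.
  elim: s => [|z' s IH].
    by rewrite big_nil -[RHS]F0; congr F; apply/funext => y; rewrite big_nil.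
  rewrite big_cons -IH -Flin; congr F; apply/funext => y.
  by rewrite big_cons.
under eq_bigr do rewrite mulrC.
rewrite -Fs; congr F; apply/funext => y.
rewrite (bigD1 y) //= eqxx mulr1 big1 ?addr0 // => z' /negbTE.
by rewrite eq_sym => ->; rewrite mulr0.
Qed.

Section Correction.
Variables (R : realType) (I J L : finType).
Variables (p : I -> J -> R) (q : I -> L -> R) (W : I -> I -> R).
Variables (S N : I -> L -> J -> R) (G : I -> pred J) (rho : I -> L -> R).
Hypothesis p_gt0 : forall i j, 0 < p i j.
Hypothesis q_gt0 : forall i l, 0 < q i l.
Hypothesis p_sum : forall i, \sum_j p i j = 1.
Hypothesis q_sum : forall i, \sum_l q i l = 1.
Hypothesis W_ge0 : forall g i, 0 <= W g i.
Hypothesis W_sum : forall i, \sum_g W g i = 1.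
Hypothesis S_ge0 : forall g l j, 0 <= S g l j.
Hypothesis S_sum : forall g j, \sum_l S g l j <= 2 / 3.
Hypothesis N_ge0 : forall g l j, 0 <= N g l j.
Hypothesis N_sum : forall g j, \sum_l N g l j = 1.
Hypothesis N_G : forall g l j, G g j -> N g l j = rho g l.
Hypothesis rho_sum : forall g, \sum_l rho g l = 1.

(* On the guess g, the row l is supplied by S g l and whatever mass S leaves over
   is spread by N g; e perturbs the supply so as to make the output exact. *)
Let T (e : I * L -> R) g l j :=
  (1 + e (g, l)) * S g l j + (1 - \sum_l' (1 + e (g, l')) * S g l' j) * N g l j.

Hypothesis off_diag : forall i l, \sum_(g | g != i) W g i *
  (\sum_j S g l j * p i j + \sum_j N g l j * p i j) <= 1 / 20 * q i l.
Hypothesis diag : forall i l, 3 / 8 * q i l <= W i i * \sum_j S i l j * p i j.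
Hypothesis rest : forall i l,
  \sum_(j | ~~ G i j) N i l j * p i j <= 1 / 20 * q i l.
Hypothesis base : forall i l,
  `|W i i * (\sum_j T (fun=> 0) i l j * p i j) - q i l| <= 1 / 20 * q i l.

Let O e i l := \sum_g W g i * \sum_j T e g l j * p i j.

Let slope e g i l := e (g, l) * (\sum_j S g l j * p i j) -
  \sum_j (\sum_l' e (g, l') * S g l' j) * N g l j * p i j.

(* The output has total mass 1 whatever e is, so its derivative is singular.
   Adding c e i * rho i l makes it diagonally dominant, and summing the solved
   equation over l shows that c vanishes at the solution. *)
Let c e i := W i i * \sum_(j | G i j) (\sum_l' e (i, l') * S i l' j) * p i j.

Let F (e : I * L -> R) (z : I * L) :=
  \sum_g W g z.1 * slope e g z.1 z.2 + c e z.1 * rho z.1 z.2.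

Let T_sum e g j : \sum_l T e g l j = 1.
Proof. by rewrite big_split /= -mulr_sumr N_sum mulr1 addrC subrK. Qed.

Let O_sum e i : \sum_l O e i l = 1.
Proof.
rewrite exchange_big /= -(W_sum i); apply: eq_bigr => g _.
rewrite -mulr_sumr exchange_big /= -[RHS]mulr1; congr (_ * _).
rewrite -(p_sum i); apply: eq_bigr => j _.
by rewrite -mulr_suml T_sum mul1r.
Qed.

(** [O] is affine in [e], with [slope] as its linear part, so solving one linear system gives an
    exact output. *)
Let OE e i l : O e i l + c e i * rho i l = O (fun=> 0) i l + F e (i, l).
Proof.
rewrite /F /= addrA; congr (_ + _); rewrite -big_split /=.
apply: eq_bigr => g _; rewrite -mulrDr; congr (_ * _).
rewrite /slope mulr_sumr -sumrB -big_split /=; apply: eq_bigr => j _.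
rewrite /T.
have -> : \sum_l' (1 + e (g, l')) * S g l' j =
    \sum_l' S g l' j + \sum_l' e (g, l') * S g l' j.
  by rewrite -big_split; apply: eq_bigr => l' _; rewrite mulrDl mul1r.
have -> : \sum_l' (1 + 0) * S g l' j = \sum_l' S g l' j.
  by apply: eq_bigr => l' _; rewrite addr0 mul1r.
rewrite addr0; ring.
Qed.

Let F_linear a u v z : F (fun z => a * u z + v z) z = a * F u z + F v z.
Proof.
have sumE g j : \sum_l' (a * u (g, l') + v (g, l')) * S g l' j =
    a * (\sum_l' u (g, l') * S g l' j) + \sum_l' v (g, l') * S g l' j.
  rewrite mulr_sumr -big_split /=; apply: eq_bigr => l _; ring.
rewrite /F mulrDr addrACA; congr (_ + _).
  rewrite mulr_sumr -big_split /=; apply: eq_bigr => g _.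
  rewrite /slope.
  have -> : \sum_j (\sum_l' (a * u (g, l') + v (g, l')) * S g l' j) *
        N g z.2 j * p z.1 j =
      a * (\sum_j (\sum_l' u (g, l') * S g l' j) * N g z.2 j * p z.1 j) +
      \sum_j (\sum_l' v (g, l') * S g l' j) * N g z.2 j * p z.1 j.
    rewrite mulr_sumr -big_split /=; apply: eq_bigr => j _; rewrite sumE; ring.
  ring.
rewrite /c.
have -> : \sum_(j | G z.1 j) (\sum_l' (a * u (z.1, l') + v (z.1, l')) *
      S z.1 l' j) * p z.1 j =
    a * (\sum_(j | G z.1 j) (\sum_l' u (z.1, l') * S z.1 l' j) * p z.1 j) +
    \sum_(j | G z.1 j) (\sum_l' v (z.1, l') * S z.1 l' j) * p z.1 j.
  rewrite mulr_sumr -big_split /=; apply: eq_bigr => j _; rewrite sumE; ring.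
ring.
Qed.

Let pull_le e B g j : (forall z, `|e z| <= B) -> 0 <= B ->
  `|\sum_l' e (g, l') * S g l' j| <= B.
Proof.
move=> eB B0; apply: le_trans (ler_norm_sum _ _ _) _.
apply: le_trans (_ : \sum_l' B * S g l' j <= _).
  by apply: ler_sum => l _; rewrite normrM (ger0_norm (S_ge0 _ _ _)) ler_wpM2r.
rewrite -mulr_sumr; have := S_sum g j; nra.
Qed.

Let dominance (e : I * L -> R) B z : (forall z', `|e z'| <= B) ->
  `|F e z - W z.1 z.1 * (\sum_j S z.1 z.2 j * p z.1 j) * e z| <=
  1 / 10 * B * q z.1 z.2.
Proof.
case: z => i l eB /=.
have B0 : 0 <= B by apply: le_trans (eB (i, l)).
have slope_le g : `|slope e g i l| <=
    B * (\sum_j S g l j * p i j + \sum_j N g l j * p i j).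
  apply: le_trans (ler_normB _ _) _; rewrite mulrDr lerD //.
    rewrite normrM [in leLHS](ger0_norm (_ : 0 <= \sum_j _)).
      by rewrite ler_wpM2r //; apply: sumr_ge0 => j _;
        rewrite mulr_ge0 // ltW.
    by apply: sumr_ge0 => j _; rewrite mulr_ge0 // ltW.
  apply: le_trans (ler_norm_sum _ _ _) _; rewrite mulr_sumr.
  apply: ler_sum => j _; rewrite !normrM -mulrA.
  rewrite (ger0_norm (N_ge0 _ _ _)) (gtr0_norm (p_gt0 _ _)).
  by rewrite ler_wpM2r ?pull_le // mulr_ge0 // ltW.
(* On a typical row [N] equals [rho], so what is taken from the leftover there cancels against
   [c e i * rho i l]. Wrong guesses and atypical rows remain, each contributing at most
   [B * q i l / 20]. *)
have -> : F e (i, l) - W i i * (\sum_j S i l j * p i j) * e (i, l) =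
    \sum_(g | g != i) W g i * slope e g i l -
    W i i * \sum_(j | ~~ G i j) (\sum_l' e (i, l') * S i l' j) * N i l j * p i j.
  rewrite /F (bigD1 i) //= /slope /c.
  rewrite [\sum_j _ * _ * _](bigID (G i)) /=.
  have -> : \sum_(j | G i j) (\sum_l' e (i, l') * S i l' j) * N i l j * p i j =
      (\sum_(j | G i j) (\sum_l' e (i, l') * S i l' j) * p i j) * rho i l.
    rewrite mulr_suml; apply: eq_bigr => j Gj; rewrite N_G //; ring.
  ring.
have h1 : `|\sum_(g | g != i) W g i * slope e g i l| <= B * (1 / 20 * q i l).
  apply: le_trans (ler_norm_sum _ _ _) _.
  apply: le_trans (ler_wpM2l B0 (off_diag i l)); rewrite mulr_sumr.
  apply: ler_sum => g _; rewrite normrM (ger0_norm (W_ge0 _ _)) mulrCA.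
  by rewrite ler_wpM2l.
have h2 : `|\sum_(j | ~~ G i j) (\sum_l' e (i, l') * S i l' j) * N i l j * p i j|
    <= B * (1 / 20 * q i l).
  apply: le_trans (ler_norm_sum _ _ _) _.
  apply: le_trans (ler_wpM2l B0 (rest i l)); rewrite mulr_sumr.
  apply: ler_sum => j _; rewrite !normrM -mulrA.
  rewrite (ger0_norm (N_ge0 _ _ _)) (gtr0_norm (p_gt0 _ _)).
  by rewrite ler_wpM2r ?pull_le // mulr_ge0 // ltW.
have W1 : W i i <= 1.
  by rewrite -(W_sum i) (bigD1 i) //= lerDl sumr_ge0.
apply: le_trans (ler_normB _ _) _.
rewrite normrM (ger0_norm (W_ge0 _ _)).
have := W_ge0 i i; have := normr_ge0
  (\sum_(j | ~~ G i j) (\sum_l' e (i, l') * S i l' j) * N i l j * p i j).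
move: h1 h2; set x := `|_|; set y := `|_|; move=> h1 h2 y0 w0.
have : W i i * y <= y by rewrite ler_piMl.
lra.
Qed.

Lemma exact_routing : exists Tx : I -> L -> J -> R,
  [/\ forall g l j, 0 <= Tx g l j, forall g j, \sum_l Tx g l j = 1 &
      forall i l, \sum_g W g i * \sum_j Tx g l j * p i j = q i l].
Proof.
pose Q (z : I * L) := q z.1 z.2.
have Q0 z : Q z != 0 by rewrite gt_eqF // q_gt0.
have O0 i l : `|O (fun=> 0) i l - q i l| <= 1 / 10 * q i l.
  rewrite /O (bigD1 i) //= addrAC.
  apply: le_trans (ler_normD _ _) _.
  suff : `|\sum_(g | g != i) W g i * (\sum_j T (fun=> 0) g l j * p i j)| <=
      1 / 20 * q i l by have := base i l; lra.
  have T0 g j : 0 <= T (fun=> 0) g l j <= S g l j + N g l j.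
    rewrite /T addr0 mul1r; under eq_bigr do rewrite mul1r.
    have s0 : 0 <= \sum_l' S g l' j by apply: sumr_ge0.
    have := S_sum g j; have := N_ge0 g l j; have := S_ge0 g l j; nra.
  rewrite ger0_norm; last first.
    apply: sumr_ge0 => g _; rewrite mulr_ge0 // sumr_ge0 // => j _.
    by rewrite mulr_ge0 ?(ltW (p_gt0 _ _)) //; case/andP: (T0 g j).
  apply: le_trans (off_diag i l); apply: ler_sum => g _.
  rewrite ler_wpM2l // -big_split /=; apply: ler_sum => j _.
  by rewrite -mulrDl ler_wpM2r ?(ltW (p_gt0 _ _)) //; case/andP: (T0 g j).
(* Each equation is divided by [q], so that errors are relative to the target row. Then [e] is at
   most (1/10) / (3/8 - 1/10) = 4/11 < 1/2. *)
have [||||e [eM eB]] := @dominant_solve R (I * L)%type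
  (fun z z' => F (fun y => (y == z')%:R) z / Q z)
  (fun z => W z.1 z.1 * (\sum_j S z.1 z.2 j * p z.1 j) / Q z)
  (1 / 10) (3 / 8) _ _ _
  (fun z => (q z.1 z.2 - O (fun=> 0) z.1 z.2) / Q z) (1 / 10).
- lra.
- by move=> z; rewrite ler_pdivlMr ?q_gt0 //; exact: diag.
- move=> e B z eB.
  under eq_bigr do rewrite mulrAC.
  rewrite -mulr_suml linear_kernel // [_ / _ * e z]mulrAC -mulrBl normrM normfV.
  rewrite (gtr0_norm (q_gt0 _ _)) ler_pdivrMr ?q_gt0 //; exact: dominance.
- move=> z; rewrite normrM normfV (gtr0_norm (q_gt0 _ _)) distrC.
  by rewrite ler_pdivrMr ?q_gt0 //; exact: O0.
have {eM}FE z : F e z = q z.1 z.2 - O (fun=> 0) z.1 z.2.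
  have := eM z; under eq_bigr do rewrite mulrAC.
  by rewrite -mulr_suml linear_kernel // => /(divIf (Q0 z)).
have {}eB z : `|e z| <= 1 / 2 by have := eB z; lra.
have Oq i l : O e i l + c e i * rho i l = q i l.
  by rewrite OE FE /= addrC subrK.
have c0 i : c e i = 0.
  have : \sum_l (O e i l + c e i * rho i l) = \sum_l q i l.
    by apply: eq_bigr => l _; rewrite Oq.
  rewrite big_split /= O_sum -mulr_sumr rho_sum q_sum mulr1; lra.
exists (T e); split.
- move=> g l j; rewrite addr_ge0 // mulr_ge0 //.
    by have := eB (g, l); rewrite ler_norml; lra.
  (* The perturbed supplies use at most 3/2 of the bound 2/3 in [S_sum], that is 1, so the leftover
     stays nonnegative. *)
  rewrite subr_ge0; apply: le_trans (_ : \sum_l' (3 / 2) * S g l' j <= _).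
    by apply: ler_sum => l' _; rewrite ler_wpM2r //;
      have := eB (g, l'); rewrite ler_norml; lra.
  by rewrite -mulr_sumr; have := S_sum g j; lra.
- exact: T_sum.
- by move=> i l; have := Oq i l; rewrite c0 mul0r addr0.
Qed.
End Correction.

(** * Supplying the rows of one family from the rows of another *)

Section Routing.
Variables (R : realType) (I : finType) (P Q V : mfamily R I).
(* gam guesses the hypothesis from V; G and G' are the typical rows of P and Q.
   An atypical row j of P is sent to r g j, an atypical row l of Q is supplied by
   t g l, and typical rows are matched at random. *)
Variables (gam : carrier V -> I) (G : I -> pred (carrier P)).
Variables (G' : I -> pred (carrier Q)) (r : I -> carrier P -> carrier Q).
Variables (t : I -> carrier Q -> carrier P) (K eps delta : R).
Local Notation J := (carrier P).
Local Notation L := (carrier Q).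
Hypothesis P1 : is_probability P.
Hypothesis Q1 : is_probability Q.
Hypothesis V1 : is_probability V.
(** [K] bounds the overshoot that a supply meant for the guess [g] can cause under another
    hypothesis, [eps] the relative weight of atypical rows under [g], and [delta] the probability of
    a wrong guess. Overshoot is harmless because [small_delta] makes [K * delta] tiny. *)
Hypothesis K1 : 1 <= K.
Hypothesis eps_ge0 : 0 <= eps.
Hypothesis delta_ge0 : 0 <= delta.
Hypothesis Jeps : #|J|%:R * eps <= 1 / 100.
Hypothesis Leps : #|L|%:R * eps <= 1 / 100.
Hypothesis small_delta : #|I|%:R * (K * (#|J|%:R + 4) * delta) <= 1 / 100.
Hypothesis guess : forall g i, g != i ->
  \sum_(z | gam z == g) mass i z <= delta.
Hypothesis r_le : forall g j, ~~ G g j ->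
  forall i, mass i j <= K * mass i (r g j).
Hypothesis r_small : forall g j, ~~ G g j -> mass g j <= eps * mass g (r g j).
Hypothesis t_le : forall g l, ~~ G' g l -> forall i,
  mass g l * mass i (t g l) <= K * (mass i l * mass g (t g l)).
Hypothesis t_small : forall g l, ~~ G' g l -> mass g l <= eps * mass g (t g l).
Hypothesis cross : forall g j l, G g j -> G' g l -> forall i,
  mass g l * mass i j <= K * (mass i l * mass g j).

Local Notation p := (@mass R I P).
Local Notation q := (@mass R I Q).
Let PG g := \sum_(j | G g j) p g j.
Let QG g := \sum_(l | G' g l) q g l.
Let W g i := \sum_(z | gam z == g) mass i z.
Let rho g l := if G' g l then q g l / QG g else 0.
Let N g l j := if G g j then rho g l else (l == r g j)%:R.
(** A typical target gets only half of its mass as supply, the rest arriving through the leftover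
    along [rho]. The half leaves headroom for perturbations in both directions. An atypical target
    gets all of its mass from the single row [t g l]. *)
Let S g l j := if G' g l then (if G g j then q g l / 2 else 0)
  else if j == t g l then q g l / p g j else 0.

Let K_ge0 : 0 <= K. Proof. exact: le_trans ler01 K1. Qed.

Let p_gt0 i j : 0 < p i j. Proof. exact: mass_gt0. Qed.
Let q_gt0 i l : 0 < q i l. Proof. exact: mass_gt0. Qed.
Let p_ge0 i j : 0 <= p i j. Proof. exact: ltW. Qed.
Let q_ge0 i l : 0 <= q i l. Proof. exact: ltW. Qed.

Let p_le1 i j : p i j <= 1.
Proof.
rewrite -(P1 i) (bigD1 j) //= lerDl; apply: sumr_ge0 => k _; exact: p_ge0.
Qed.

Let q_le1 i l : q i l <= 1.
Proof.
rewrite -(Q1 i) (bigD1 l) //= lerDl; apply: sumr_ge0 => k _; exact: q_ge0.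
Qed.

Let PG_bound g : 99 / 100 <= PG g <= 1.
Proof.
have E : PG g + \sum_(j | ~~ G g j) p g j = 1 by rewrite -(P1 g) [RHS](bigID (G g)).
have n0 : 0 <= \sum_(j | ~~ G g j) p g j by apply: sumr_ge0 => j _.
have : \sum_(j | ~~ G g j) p g j <= #|J|%:R * eps.
  apply: le_trans (_ : \sum_(j : J) eps <= _).
    rewrite [leRHS](bigID (fun j => ~~ G g j)) /=.
    rewrite -[leLHS]addr0 lerD ?sumr_ge0 //; apply: ler_sum => j Gj.
    by apply: (le_trans (r_small Gj)); rewrite ler_piMr.
  by rewrite sumr_const mulr_natl.
move=> h; have {}h := le_trans h Jeps; lra.
Qed.

Let QG_bound g : 99 / 100 <= QG g <= 1.
Proof.
have E : QG g + \sum_(l | ~~ G' g l) q g l = 1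
  by rewrite -(Q1 g) [RHS](bigID (G' g)).
have n0 : 0 <= \sum_(l | ~~ G' g l) q g l by apply: sumr_ge0 => l _.
have : \sum_(l | ~~ G' g l) q g l <= #|L|%:R * eps.
  apply: le_trans (_ : \sum_(l : L) eps <= _).
    rewrite [leRHS](bigID (fun l => ~~ G' g l)) /=.
    rewrite -[leLHS]addr0 lerD ?sumr_ge0 //; apply: ler_sum => l Gl.
    by apply: (le_trans (t_small Gl)); rewrite ler_piMr.
  by rewrite sumr_const mulr_natl.
move=> h; have {}h := le_trans h Leps; lra.
Qed.

Let q_rest g : \sum_(l | ~~ G' g l) q g l = 1 - QG g.
Proof. by rewrite -(Q1 g) [in RHS](bigID (G' g)) /= addrC addrK. Qed.

Let S_ge0 g l j : 0 <= S g l j.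
Proof.
by rewrite /S; case: ifP => _; case: ifP => _ //; rewrite divr_ge0.
Qed.

(** The share of row [j] claimed by atypical targets; [t_small] limits each claim to [eps]. *)
Let x g j := \sum_(l | ~~ G' g l) (if j == t g l then q g l / p g j else 0).

Let S_sumE g j : \sum_l S g l j = (if G g j then QG g / 2 else 0) + x g j.
Proof.
rewrite (bigID (G' g)) /=; congr (_ + _).
  case: ifP => Gj.
    by rewrite mulr_suml; apply: eq_bigr => l Gl; rewrite /S Gl Gj.
  by apply: big1 => l Gl; rewrite /S Gl Gj.
by apply: eq_bigr => l /negbTE Gl; rewrite /S Gl.
Qed.

Let S_sum g j : \sum_l S g l j <= 2 / 3.
Proof.
rewrite S_sumE.
have : x g j <= #|L|%:R * eps.
  apply: le_trans (_ : \sum_(l : L) eps <= _); last first.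
    by rewrite sumr_const mulr_natl.
  rewrite [leRHS](bigID (fun l => ~~ G' g l)) /=.
  rewrite -[leLHS]addr0 lerD ?sumr_ge0 //; apply: ler_sum => l Gl.
  by case: eqP => [->|//]; rewrite ler_pdivrMr //; exact: t_small.
move=> h; have {}h := le_trans h Leps.
by have := QG_bound g; case: ifP => _; lra.
Qed.

Let rho_ge0 g l : 0 <= rho g l.
Proof.
rewrite /rho; case: ifP => _ //; rewrite divr_ge0 //.
by have := QG_bound g; lra.
Qed.

Let rho_sum g : \sum_l rho g l = 1.
Proof.
have QG0 : 0 < QG g by have := QG_bound g; lra.
by rewrite /rho -big_mkcond /= -mulr_suml divff // gt_eqF.
Qed.

Let N_ge0 g l j : 0 <= N g l j.
Proof. by rewrite /N; case: ifP => _; [exact: rho_ge0|rewrite ler0n]. Qed.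

Let N_sum g j : \sum_l N g l j = 1.
Proof.
rewrite /N; case: (G g j); first exact: rho_sum.
by rewrite (bigD1 (r g j)) //= eqxx big1 ?addr0 // => l /negbTE ->.
Qed.

Let SpE g i l : \sum_j S g l j * p i j =
  if G' g l then q g l / 2 * \sum_(j | G g j) p i j
  else q g l / p g (t g l) * p i (t g l).
Proof.
rewrite /S; case: ifP => Gl.
  rewrite mulr_sumr [RHS]big_mkcond; apply: eq_bigr => j _.
  by case: ifP => _; rewrite ?mul0r.
rewrite (bigD1 (t g l)) //= eqxx big1 ?addr0 // => j /negbTE ->.
by rewrite mul0r.
Qed.

Let cross_sum g l i : G' g l -> q g l * \sum_(j | G g j) p i j <= K * q i l.
Proof.
move=> Gl; apply: le_trans (_ : K * q i l * PG g <= _); last first.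
  rewrite ler_piMr //; last by have := PG_bound g; lra.
  by rewrite mulr_ge0.
rewrite !mulr_sumr; apply: ler_sum => j Gj; rewrite -mulrA.
exact: cross.
Qed.

Let Sp_le g i l : \sum_j S g l j * p i j <= K * q i l.
Proof.
have K0 : 0 <= K * q i l by rewrite mulr_ge0.
rewrite SpE; case: ifP => Gl; first by have := cross_sum i Gl; lra.
rewrite mulrAC ler_pdivrMr // -mulrA; apply: t_le; exact: negbT.
Qed.

Let rest_le g i l : \sum_(j | ~~ G g j) N g l j * p i j <= #|J|%:R * (K * q i l).
Proof.
have K0 : 0 <= K * q i l by rewrite mulr_ge0.
apply: le_trans (_ : \sum_(j : J) K * q i l <= _); last first.
  by rewrite sumr_const mulr_natl.
rewrite [leRHS](bigID (fun j => ~~ G g j)) /=.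
rewrite -[leLHS]addr0 lerD ?sumr_ge0 //; apply: ler_sum => j Gj.
rewrite /N (negbTE Gj); case: eqP => [->|_]; last by rewrite mul0r.
by rewrite mul1r; exact: r_le.
Qed.

Let Np_le g i l : \sum_j N g l j * p i j <= (2 + #|J|%:R) * (K * q i l).
Proof.
have K0 : 0 <= K * q i l by rewrite mulr_ge0.
rewrite (bigID (G g)) /= mulrDl; apply: lerD; last first.
  exact: (rest_le g i l).
have -> : \sum_(j | G g j) N g l j * p i j = rho g l * \sum_(j | G g j) p i j.
  by rewrite mulr_sumr; apply: eq_bigr => j Gj; rewrite /N Gj.
rewrite /rho; case: ifP => Gl; last by rewrite mul0r; lra.
have QG0 : 0 < QG g by have := QG_bound g; lra.
rewrite mulrAC ler_pdivrMr //; apply: le_trans (cross_sum i Gl) _.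
by have := QG_bound g; nra.
Qed.

Let W_ge0 g i : 0 <= W g i.
Proof. by apply: sumr_ge0 => z _; exact: ltW (mass_gt0 _ _). Qed.

Let W_sum i : \sum_g W g i = 1.
Proof. by rewrite -(V1 i) (partition_big gam xpredT). Qed.

Let Idelta : #|I|%:R * delta <= 1 / 100.
Proof.
apply: le_trans small_delta; rewrite ler_wpM2l // ler_peMl //.
rewrite -[leLHS]mul1r ler_pM //.
by rewrite -natrD -[1]/(1%:R) ler_nat addnS.
Qed.

Let Wii i : 99 / 100 <= W i i <= 1.
Proof.
have E : W i i + \sum_(g | g != i) W g i = 1 by rewrite -(W_sum i) [RHS](bigD1 i).
have n0 : 0 <= \sum_(g | g != i) W g i by apply: sumr_ge0.
have : \sum_(g | g != i) W g i <= #|I|%:R * delta.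
  apply: le_trans (_ : \sum_(g : I) delta <= _); last first.
    by rewrite sumr_const mulr_natl.
  rewrite [leRHS](bigID (fun g => g != i)) /=.
  rewrite -[leLHS]addr0 lerD ?sumr_ge0 //; apply: ler_sum => g gi.
  exact: guess.
move=> h; have {}h := le_trans h Idelta; lra.
Qed.

Let off i l : \sum_(g | g != i) W g i *
  (\sum_j S g l j * p i j + \sum_j N g l j * p i j) <= 1 / 20 * q i l.
Proof.
have K0 : 0 <= K * q i l by rewrite mulr_ge0.
have J0 : 0 <= #|J|%:R :> R by [].
apply: le_trans (_ : \sum_(g : I) delta * ((#|J|%:R + 4) * (K * q i l)) <= _).
  rewrite [leRHS](bigID (fun g => g != i)) /=.
  rewrite -[leLHS]addr0 lerD //; last first.
    by apply: sumr_ge0 => g _; rewrite !mulr_ge0.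
  apply: ler_sum => g gi; apply: ler_pM => //.
  - rewrite addr_ge0 //; apply: sumr_ge0 => j _; rewrite mulr_ge0 //.
  - exact: guess.
  - by have := Sp_le g i l; have := Np_le g i l; lra.
rewrite sumr_const -[leLHS]mulr_natl.
rewrite [leLHS](_ : _ = #|I|%:R * (K * (#|J|%:R + 4) * delta) * q i l); last by ring.
rewrite ler_wpM2r //; apply: le_trans small_delta _; lra.
Qed.

Let diag i l : 3 / 8 * q i l <= W i i * \sum_j S i l j * p i j.
Proof.
have -> : \sum_j S i l j * p i j = if G' i l then q i l / 2 * PG i else q i l.
  by rewrite SpE; case: ifP => // _; rewrite divfK // gt_eqF.
have := Wii i; have := PG_bound i; have := q_gt0 i l.
case: ifP => _ q0 PG1 W1; last by nra.
have : 495 / 1000 * q i l <= q i l / 2 * PG i by nra.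
have : 0 <= q i l / 2 * PG i by nra.
move: (q i l / 2 * PG i) => y; nra.
Qed.

Let rest_small i l : 0 <= \sum_(j | ~~ G i j) N i l j * p i j <= 1 / 100 * q i l.
Proof.
apply/andP; split; first by apply: sumr_ge0 => j _; rewrite mulr_ge0.
apply: le_trans (_ : #|J|%:R * eps * q i l <= _); last by rewrite ler_wpM2r.
apply: le_trans (_ : \sum_(j : J) eps * q i l <= _); last first.
  by rewrite sumr_const -[leLHS]mulr_natl mulrA.
rewrite [leRHS](bigID (fun j => ~~ G i j)) /=.
rewrite -[leLHS]addr0 lerD //; last first.
  by apply: sumr_ge0 => j _; rewrite mulr_ge0.
apply: ler_sum => j Gj.
rewrite /N (negbTE Gj); case: eqP => [->|_]; last by rewrite mul0r mulr_ge0.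
by rewrite mul1r; exact: r_small.
Qed.

Let x_sum i : 0 <= \sum_(j | G i j) x i j * p i j <= 1 / 100.
Proof.
have x0 j : 0 <= x i j.
  by apply: sumr_ge0 => l _; case: ifP => // _; rewrite divr_ge0.
apply/andP; split; first by apply: sumr_ge0 => j _; rewrite mulr_ge0.
apply: le_trans (_ : 1 - QG i <= _); last by have := QG_bound i; lra.
rewrite -q_rest.
apply: le_trans (_ : \sum_j x i j * p i j <= _).
  rewrite [leRHS](bigID (G i)) /= lerDl; apply: sumr_ge0 => j _.
  by rewrite mulr_ge0.
under eq_bigr do rewrite mulr_suml.
rewrite exchange_big /=; apply: ler_sum => l Gl.
rewrite (bigD1 (t i l)) //= eqxx big1 ?addr0 => [|j /negbTE ->].
  by rewrite divfK // gt_eqF.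
by rewrite mul0r.
Qed.

Let base0 i l : `|\sum_j (S i l j + (1 - \sum_l' S i l' j) * N i l j) * p i j -
  q i l| <= 3 / 100 * q i l.
Proof.
have QG0 : 0 < QG i by have := QG_bound i; lra.
pose Y := \sum_(j | ~~ G i j) (1 - \sum_l' S i l' j) * N i l j * p i j.
have Y0 : 0 <= Y <= 1 / 100 * q i l.
  have /andP[_ h] := rest_small i l; apply/andP; split.
    apply: sumr_ge0 => j _; rewrite !mulr_ge0 // subr_ge0.
    by have := S_sum i j; lra.
  apply: le_trans h; apply: ler_sum => j _.
  rewrite -mulrA ler_piMl // ?mulr_ge0 // gerBl; exact: sumr_ge0.
pose X := \sum_(j | G i j) x i j * p i j.
have -> : \sum_j (S i l j + (1 - \sum_l' S i l' j) * N i l j) * p i j =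
    \sum_j S i l j * p i j + rho i l * (PG i * (1 - QG i / 2) - X) + Y.
  under eq_bigr do rewrite mulrDl.
  rewrite big_split /= -addrA; congr (_ + _).
  rewrite (bigID (G i)) /=; congr (_ + _).
  rewrite /PG mulr_suml -sumrB mulr_sumr; apply: eq_bigr => j Gj.
  by rewrite S_sumE /N Gj; ring.
rewrite SpE -/(PG i) /rho; case: ifP => Gl.
  (* The direct half and the half missing from the leftover cancel, so the relative error comes only
     from atypical mass: [PG i] and [QG i] lie within 1/100 of 1, and [X] is at most 1/100. *)
  have -> : q i l / 2 * PG i + q i l / QG i * (PG i * (1 - QG i / 2) - X) =
      q i l * ((PG i - X) / QG i).
    by field; rewrite gt_eqF.
  have := x_sum i; rewrite -/X => X0.
  have : 98 / 100 <= (PG i - X) / QG i <= 102 / 100.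
    rewrite ler_pdivlMr // ler_pdivrMr //.
    by have := PG_bound i; have := QG_bound i; lra.
  have := q_gt0 i l; move: ((PG i - X) / QG i) => y q0 yb.
  by rewrite ler_norml; nra.
rewrite divfK ?gt_eqF // mul0r addr0 addrAC subrr add0r.
by rewrite ger0_norm; have := q_gt0 i l; lra.
Qed.

Lemma routing_majorizes : majorizes (tensor V P) Q.
Proof.
have [] := @exact_routing R I J L p q W S N G rho p_gt0 q_gt0 P1 Q1
   W_ge0 W_sum S_ge0 S_sum N_ge0 N_sum _ rho_sum off diag _ _.
- by move=> g l j Gj; rewrite /N Gj.
- by move=> i l; have /andP[_ h] := rest_small i l; have := q_gt0 i l; lra.
- move=> i l.
  have -> : \sum_j ((1 + 0) * S i l j +
      (1 - \sum_l' (1 + 0) * S i l' j) * N i l j) * p i j =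
      \sum_j (S i l j + (1 - \sum_l' S i l' j) * N i l j) * p i j.
    apply: eq_bigr => j _; rewrite addr0 mul1r.
    by under eq_bigr do rewrite mul1r.
  have := base0 i l; move: (\sum_j _) => b; rewrite !ler_norml.
  have := Wii i; have := q_gt0 i l; nra.
move=> T [T0 T1 TE].
(* The channel reads the guess off the [V] component and then applies the corrected routing for that
   guess. *)
exists (fun l zj => T (gam zj.1) l zj.2); split; first split.
- by move=> l zj.
- by move=> zj.
- move=> i l; rewrite -[LHS](TE i l).
  rewrite -(pair_bigA _ (fun z j => T (gam z) l j * (mass i z * mass i j))) /=.
  rewrite [RHS](partition_big gam xpredT) //=; apply: eq_bigr => g _.
  rewrite /W mulr_suml; apply: eq_bigr => z /eqP <-.
  by rewrite mulr_sumr; apply: eq_bigr => j _; ring.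
Qed.
End Routing.

(** * Relative entropy and convex duality *)

Section RelativeEntropy.
Variables (R : realType) (X : finType).
Implicit Types t a b : X -> R.

Definition distr t := (forall x, 0 <= t x) /\ \sum_x t x = 1.

(** Relative entropy in nats. The factor [t x] kills the terms with [t x = 0], whatever value [ln]
    takes at 0; positivity of [a] is required separately wherever it matters. *)
Definition kl t a := \sum_x t x * (ln (t x) - ln (a x)).

Lemma distr_le1 t x : distr t -> t x <= 1.
Proof. by move=> [t0 <-]; rewrite (bigD1 x) //= lerDl sumr_ge0. Qed.

Lemma distr_mix (th : R) t b : 0 <= th <= 1 -> distr t -> distr b ->
  distr (fun x => (1 - th) * t x + th * b x).
Proof.
move=> th01 [t0 t1] [b0 b1]; split.
  by move=> x; rewrite addr_ge0 // mulr_ge0 //; lra.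
by rewrite big_split /= -!mulr_sumr t1 b1; lra.
Qed.

Lemma ln_leB1 (x : R) : 0 < x -> ln x <= x - 1.
Proof.
move=> x0; have := @le_ln1Dx R (x - 1); rewrite (addrCA 1 x) subrr addr0; apply.
by rewrite ltrBrDl subrr.
Qed.

Lemma ln_geB1V (x : R) : 0 < x -> 1 - x^-1 <= ln x.
Proof.
move=> x0; have := @ln_leB1 x^-1; rewrite invr_gt0 lnV // => /(_ x0); lra.
Qed.

Lemma xlnx_tangent (x y : R) : 0 <= x -> 0 < y ->
  x * ln y + x - y <= x * ln x.
Proof.
rewrite le_eqVlt => /predU1P[<-|x0] y0; first by rewrite !mul0r; lra.
have := @ln_leB1 (y / x) (divr_gt0 y0 x0); rewrite ln_div ?posrE // => h.
have : x * (ln y - ln x) <= x * (y / x - 1) by rewrite ler_wpM2l // ltW.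
rewrite [x * (y / x - 1)]mulrBr mulrCA divff ?gt_eqF //; lra.
Qed.

Lemma xlnx_ge_sqrt (x : R) : 0 <= x -> - (2 * Num.sqrt x) <= x * ln x.
Proof.
rewrite le_eqVlt => /predU1P[<-|x0]; first by rewrite sqrtr0 mulr0 mul0r oppr0.
set s := Num.sqrt x; have s0 : 0 < s by rewrite sqrtr_gt0.
have xs : x = s ^+ 2 by rewrite sqr_sqrtr // ltW.
have := ln_geB1V s0; rewrite xs lnXn // => h.
have : s ^+ 2 * (1 - s^-1) <= s ^+ 2 * ln s by rewrite ler_wpM2l // sqr_ge0.
rewrite mulrBr expr2 -[s * s / s]mulrA divff ?gt_eqF // -mulr_natl; nra.
Qed.

(** The derivative of x ln x is unbounded at 0, so the modulus of continuity involves a square root.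
    For [x <= y] superadditivity reduces the claim to [xlnx_ge_sqrt]; for [y < x] the tangent at [x]
    suffices since [ln x <= 0]. *)
Lemma xlnx_mod (x y d : R) : 0 <= x <= 1 -> 0 <= y <= 1 -> `|x - y| <= d ->
  x * ln x <= y * ln y + 2 * Num.sqrt d + d.
Proof.
move=> /andP[x0 x1] /andP[y0 y1] xyd.
have d0 : 0 <= d by apply: le_trans xyd.
have s0 : 0 <= Num.sqrt d := sqrtr_ge0 _.
have [xy|yx] := leP x y; last first.
  have xp : 0 < x by apply: le_lt_trans yx.
  have := xlnx_tangent y0 xp; have := ln_le0 x1.
  move: xyd; rewrite ger0_norm; last by rewrite subr_ge0 ltW.
  nra.
move: xyd; rewrite distrC ger0_norm ?subr_ge0 // => xyd.
have sd : Num.sqrt (y - x) <= Num.sqrt d by rewrite ler_wsqrtr.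
suff : x * ln x + (y - x) * ln (y - x) <= y * ln y.
  have yx0 : 0 <= y - x by lra.
  by have := xlnx_ge_sqrt yx0; lra.
have mono (u v : R) : 0 <= u -> u <= v -> u * ln u <= u * ln v.
  rewrite le_eqVlt => /predU1P[<-|u0] uv; first by rewrite !mul0r.
  by rewrite ler_wpM2l ?(ltW u0) // ler_ln ?posrE // (lt_le_trans u0).
have -> : y * ln y = x * ln y + (y - x) * ln y by ring.
by rewrite lerD // mono //; lra.
Qed.

Lemma kl_term_ge (x y : R) : 0 <= x -> 0 < y ->
  x - y + (Num.sqrt x - Num.sqrt y) ^+ 2 <= x * (ln x - ln y).
Proof.
rewrite le_eqVlt => /predU1P[<-|x0] y0.
  by rewrite sqrtr0 !sub0r sqrrN sqr_sqrtr ?(ltW y0) // addNr mul0r.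
set s := Num.sqrt x; have s0 : 0 < s by rewrite sqrtr_gt0.
set b := Num.sqrt y; have b0 : 0 < b by rewrite sqrtr_gt0.
have xs : x = s ^+ 2 by rewrite sqr_sqrtr // ltW.
have yb : y = b ^+ 2 by rewrite sqr_sqrtr // ltW.
rewrite xs yb !lnXn //.
have := @ln_leB1 (b / s) (divr_gt0 b0 s0); rewrite ln_div ?posrE // => h.
have : s ^+ 2 * (ln b - ln s) <= s ^+ 2 * (b / s - 1).
  by rewrite ler_wpM2l // sqr_ge0.
have -> : s ^+ 2 * (b / s - 1) = s * b - s ^+ 2 by field; rewrite gt_eqF.
rewrite !mulr2n; lra.
Qed.

(** A weak Pinsker inequality through the Hellinger distance: the factor 4 bounds the square of the
    sum of the two roots. It is the origin of the 4 in the later thresholds [kap ^+ 2 / 4] and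
    [xi ^+ 2 / 4]. *)
Lemma kl_ge_sq t a x : distr t -> distr a -> (forall x, 0 < a x) ->
  (t x - a x) ^+ 2 <= 4 * kl t a.
Proof.
move=> td ad a0.
have : (Num.sqrt (t x) - Num.sqrt (a x)) ^+ 2 <= kl t a.
  have -> : kl t a = \sum_x (t x * (ln (t x) - ln (a x)) - (t x - a x)).
    by rewrite sumrB sumrB td.2 ad.2 subrr subr0.
  rewrite (bigD1 x) //= -[leLHS]addr0 lerD ?sumr_ge0 //.
    by have := kl_term_ge (td.1 x) (a0 x); lra.
  move=> y _; have := kl_term_ge (td.1 y) (a0 y).
  by have := sqr_ge0 (Num.sqrt (t y) - Num.sqrt (a y)); lra.
have tx := td.1 x; have ax := ltW (a0 x).
have := sqr_sqrtr tx; have := sqr_sqrtr ax.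
have : Num.sqrt (t x) <= 1 by rewrite -sqrtr1 ler_wsqrtr // distr_le1.
have : Num.sqrt (a x) <= 1 by rewrite -sqrtr1 ler_wsqrtr // distr_le1.
move: (Num.sqrt (t x)) (Num.sqrt (a x)) (sqrtr_ge0 (t x)) (sqrtr_ge0 (a x)).
move=> s b s0 b0 b1 s1 <- <- h.
have -> : (s ^+ 2 - b ^+ 2) ^+ 2 = (s + b) ^+ 2 * (s - b) ^+ 2 by ring.
apply: le_trans (_ : 4 * (s - b) ^+ 2 <= _); last by rewrite ler_wpM2l.
by rewrite ler_wpM2r ?sqr_ge0 //; nra.
Qed.

Lemma kl_ge0 t a : distr t -> distr a -> (forall x, 0 < a x) -> 0 <= kl t a.
Proof.
move=> td ad a0.
have -> : kl t a = \sum_x (t x * (ln (t x) - ln (a x)) - (t x - a x)).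
  by rewrite sumrB sumrB td.2 ad.2 subrr subr0.
apply: sumr_ge0 => x _; have := kl_term_ge (td.1 x) (a0 x).
by have := sqr_ge0 (Num.sqrt (t x) - Num.sqrt (a x)); lra.
Qed.

Lemma klxx a : kl a a = 0.
Proof. by apply: big1 => x _; rewrite subrr mulr0. Qed.

Lemma kl_eq0 t a : distr t -> distr a -> (forall x, 0 < a x) ->
  kl t a <= 0 -> t = a.
Proof.
move=> td ad a0 k0; apply/funext => x; apply/eqP.
rewrite -subr_eq0 -sqrf_eq0 eq_le sqr_ge0 andbT.
by apply: le_trans (kl_ge_sq x td ad a0) _; lra.
Qed.

Lemma kl_le t a (C : R) : distr t -> (forall x, - C <= ln (a x)) -> kl t a <= C.
Proof.
move=> td aC; rewrite -[C]mul1r -td.2 mulr_suml; apply: ler_sum => x _.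
rewrite ler_wpM2l ?td.1 //; have := aC x; have := ln_le0 (distr_le1 x td); lra.
Qed.

Lemma kl_mix (th : R) t b a : 0 <= th <= 1 -> distr t -> distr b ->
  kl (fun x => (1 - th) * t x + th * b x) a <= (1 - th) * kl t a + th * kl b a.
Proof.
move=> th01 [t0 _] [b0 _]; rewrite /kl !mulr_sumr -big_split /=.
apply: ler_sum => x _; set m := _ + _.
have m0 : 0 <= m by rewrite addr_ge0 // mulr_ge0 //; lra.
suff : m * ln m <= (1 - th) * (t x * ln (t x)) + th * (b x * ln (b x)).
  by rewrite /m; lra.
move: m0; rewrite le_eqVlt => /predU1P[m0|m0].
  rewrite -m0 mul0r.
  have t1 : 0 <= (1 - th) * t x by rewrite mulr_ge0 //; lra.
  have b1 : 0 <= th * b x by rewrite mulr_ge0 //; lra.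
  have t2 : (1 - th) * t x = 0 by move: m0; rewrite /m; lra.
  have b2 : th * b x = 0 by move: m0; rewrite /m; lra.
  by rewrite !mulrA t2 b2 !mul0r addr0.
have th0 : 0 <= th by lra.
have th1 : 0 <= 1 - th by lra.
have := ler_wpM2l th1 (xlnx_tangent (t0 x) m0).
have := ler_wpM2l th0 (xlnx_tangent (b0 x) m0).
move: (ln m) => l; rewrite /m; nra.
Qed.

(** The mesh is a square because [xlnx_mod] takes its root; the loss per point is 2k + k^2 + k^2 C,
    at most k (3 + C). *)
Lemma kl_near t t' a (k C : R) : distr t -> distr t' -> 0 <= k <= 1 ->
  (forall x, `|ln (a x)| <= C) -> (forall x, `|t x - t' x| <= k ^+ 2) ->
  kl t a <= kl t' a + #|X|%:R * (k * (3 + C)).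
Proof.
move=> td td' k01 aC tt'.
rewrite /kl [#|X|%:R * _]mulr_natl -sumr_const -big_split /=.
apply: ler_sum => x _.
have := @xlnx_mod (t x) (t' x) (k ^+ 2); rewrite td.1 td'.1 !distr_le1 //.
move=> /(_ isT isT (tt' x)); rewrite sqrtr_sqr ger0_norm; last by lra.
have : `|(t x - t' x) * ln (a x)| <= k ^+ 2 * C by rewrite normrM ler_pM.
rewrite ler_norml => /andP[h _].
have C0 : 0 <= C by apply: le_trans (aC x).
have k2 : k ^+ 2 <= k by nra.
have : k ^+ 2 * C <= k * C by rewrite ler_wpM2r.
lra.
Qed.

(** The entropy of [t] cancels, so differences are linear in [t]: exact under mixtures and Lipschitz
    under rounding. *)
Lemma kl_diff t a b : kl t a - kl t b = \sum_x t x * (ln (b x) - ln (a x)).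
Proof. rewrite /kl -sumrB; apply: eq_bigr => x _; ring. Qed.

Lemma kl_diff_near t t' a b (k C : R) :
  (forall x, `|ln (a x)| <= C) -> (forall x, `|ln (b x)| <= C) ->
  (forall x, `|t x - t' x| <= k) ->
  kl t a - kl t b <= kl t' a - kl t' b + #|X|%:R * (k * (2 * C)).
Proof.
move=> aC bC tt'; rewrite !kl_diff [#|X|%:R * _]mulr_natl -sumr_const -big_split /=.
apply: ler_sum => x _.
have : `|(t x - t' x) * (ln (b x) - ln (a x))| <= k * (2 * C).
  rewrite normrM ler_pM //; apply: le_trans (ler_normB _ _) _.
  by have := aC x; have := bC x; lra.
by rewrite ler_norml => /andP[_ h]; lra.
Qed.

Lemma kl_diff_mix (th : R) t s a b : 
  kl (fun x => (1 - th) * t x + th * s x) a -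
  kl (fun x => (1 - th) * t x + th * s x) b =
  (1 - th) * (kl t a - kl t b) + th * (kl s a - kl s b).
Proof.
rewrite !kl_diff !mulr_sumr -big_split /=; apply: eq_bigr => x _; ring.
Qed.

Lemma kl_diff_bound t a b (C : R) : distr t ->
  (forall x, `|ln (a x)| <= C) -> (forall x, `|ln (b x)| <= C) ->
  `|kl t a - kl t b| <= 2 * C.
Proof.
move=> td aC bC; rewrite kl_diff.
apply: le_trans (ler_norm_sum _ _ _) _.
have -> : 2 * C = \sum_x t x * (2 * C) by rewrite -mulr_suml td.2 mul1r.
apply: ler_sum => x _; rewrite normrM (ger0_norm (td.1 x)) ler_wpM2l ?td.1 //.
by apply: le_trans (ler_normB _ _) _; have := aC x; have := bC x; lra.
Qed.
End RelativeEntropy.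

Lemma expR_le_quad {R : realType} (x : R) : x <= 1 / 2 ->
  expR x <= 1 + x + 2 * x ^+ 2.
Proof.
move=> x2; have := expR_ge1Dx (- x); rewrite expRN => h.
have e0 := expR_gt0 x.
have {}h : (1 - x) * expR x <= 1.
  by rewrite -ler_pdivlMr // div1r.
have : 1 <= (1 - x) * (1 + x + 2 * x ^+ 2).
  have : 0 <= x ^+ 2 * (1 - 2 * x) by rewrite mulr_ge0 ?sqr_ge0 //; lra.
  lra.
move=> h'; rewrite -(ler_pM2l (_ : 0 < 1 - x)); last by lra.
lra.
Qed.

(** First-order optimality without derivatives: a quadratic error cannot compensate a negative slope
    for small [t]. *)
Lemma slope_ge0 {R : realType} (s c t0 : R) : 0 < t0 -> 0 <= c ->
  (forall t, 0 < t <= t0 -> - (t ^+ 2 * c) <= t * s) -> 0 <= s.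
Proof.
move=> t00 c0 h; rewrite leNgt; apply/negP => s0.
pose t := Num.min t0 (- s / (2 * (c + 1))).
have tp : 0 < t.
  by rewrite /t lt_min t00 /= divr_gt0 //; lra.
have := h t; rewrite tp ge_min lexx => /(_ isT).
have : t <= - s / (2 * (c + 1)) by rewrite /t ge_min lexx orbT.
rewrite ler_pdivlMr; last by lra.
have : 0 <= t * c by rewrite mulr_ge0 // ltW.
nra.
Qed.

Lemma continuous_bigsum {R : realType} {T : topologicalType} {I : finType}
    (F : I -> T -> R) :
  (forall i, continuous (F i)) -> continuous (fun x => \sum_i F i x).
Proof.
move=> Fc; rewrite /index_enum; elim: (Finite.enum I) => [|i s IH] x.
  under eq_fun do rewrite big_nil; exact: cvg_cst.
under eq_fun do rewrite big_cons.
by apply: (@continuousD R R T (F i) (fun x => \sum_(i <- s) F i x));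
  [exact: Fc|exact: IH].
Qed.

(** * Gibbs distributions and Lagrangian duality *)

Section Gibbs.
Variables (R : realType) (I X : finType) (A : I -> X -> R).
Hypothesis X_gt0 : (0 < #|X|)%N.
Implicit Types alpha : I -> R.

(** Its exponential is the product of the powers [A i x] to the [alpha i], so [logZ] is the
    logarithm occurring in [renyi], and [gibbs] is the normalized geometric mixture of the
    hypotheses. *)
Definition energy alpha x := \sum_i alpha i * ln (A i x).
Definition logZ alpha := ln (\sum_x expR (energy alpha x)).
Definition gibbs alpha x := expR (energy alpha x - logZ alpha).

Lemma Z_gt0 alpha : 0 < \sum_x expR (energy alpha x).
Proof.
have [x _] := card_gt0P X_gt0.
rewrite (bigD1 x) //=; apply: ltr_wpDr; last exact: expR_gt0.
by apply: sumr_ge0 => y _; exact: expR_ge0.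
Qed.

Lemma gibbs_gt0 alpha x : 0 < gibbs alpha x.
Proof. exact: expR_gt0. Qed.

Lemma gibbs_distr alpha : distr (gibbs alpha).
Proof.
split => [x|]; first exact/ltW/gibbs_gt0.
under eq_bigr do rewrite /gibbs expRD expRN.
by rewrite -mulr_suml lnK ?posrE ?Z_gt0 // divff // gt_eqF ?Z_gt0.
Qed.

Lemma ln_gibbs alpha x : ln (gibbs alpha x) = energy alpha x - logZ alpha.
Proof. exact: expRK. Qed.

(** The Gibbs variational identity. Only the sum of [alpha] enters, to collect the terms [ln (t x)],
    so negative weights are allowed. *)
Lemma gibbs_variational alpha t : distr t -> \sum_i alpha i = 1 ->
  \sum_i alpha i * kl t (A i) = kl t (gibbs alpha) - logZ alpha.
Proof.
move=> [t0 t1] a1.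
have -> : kl t (gibbs alpha) - logZ alpha =
    \sum_x t x * (ln (t x) - energy alpha x).
  rewrite /kl -[logZ alpha]mul1r -t1 mulr_suml -sumrB.
  by apply: eq_bigr => x _; rewrite ln_gibbs; ring.
rewrite /kl; under eq_bigr do rewrite mulr_sumr.
rewrite exchange_big /=; apply: eq_bigr => x _.
rewrite -[ln (t x) in RHS]mul1r -a1 /energy mulr_suml -sumrB mulr_sumr.
by apply: eq_bigr => i _; ring.
Qed.

Lemma energyD alpha beta (s : R) x :
  energy (fun i => alpha i + s * beta i) x = energy alpha x + s * energy beta x.
Proof.
rewrite /energy mulr_sumr -big_split /=; apply: eq_bigr => i _; ring.
Qed.

Lemma logZ_le alpha beta (c s : R) : 0 <= s ->
  (forall x, `|energy beta x| <= c) -> s * c <= 1 / 2 ->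
  logZ (fun i => alpha i + s * beta i) <= logZ alpha +
    s * (\sum_x gibbs alpha x * energy beta x) + s ^+ 2 * (2 * c ^+ 2).
Proof.
move=> s0 ec sc.
have -> : logZ (fun i => alpha i + s * beta i) = logZ alpha +
    ln (\sum_x gibbs alpha x * expR (s * energy beta x)).
  rewrite /logZ -lnM ?posrE ?Z_gt0 //; last first.
    have [x _] := card_gt0P X_gt0.
    rewrite (bigD1 x) //=; apply: ltr_wpDr.
      by apply: sumr_ge0 => y _; rewrite mulr_ge0 // ?expR_ge0 // ltW // gibbs_gt0.
    by rewrite mulr_gt0 ?expR_gt0 ?gibbs_gt0.
  congr ln; rewrite mulr_sumr; apply: eq_bigr => x _.
  rewrite energyD expRD mulrA; congr (_ * _).
  by rewrite /gibbs expRD expRN lnK ?posrE ?Z_gt0 // mulrCA divff ?mulr1 ?gt_eqF ?Z_gt0.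
rewrite -addrA lerD2l.
have [g0 g1] := gibbs_distr alpha.
apply: le_trans (ln_leB1 _) _.
  have [x _] := card_gt0P X_gt0.
  rewrite (bigD1 x) //=; apply: ltr_wpDr.
    by apply: sumr_ge0 => y _; rewrite mulr_ge0 // ?expR_ge0.
  by rewrite mulr_gt0 ?expR_gt0 ?gibbs_gt0.
have -> : \sum_x gibbs alpha x * expR (s * energy beta x) - 1 =
    \sum_x gibbs alpha x * (expR (s * energy beta x) - 1).
  rewrite -[X in _ - X]g1 -sumrB; apply: eq_bigr => x _; ring.
have -> : s * (\sum_x gibbs alpha x * energy beta x) + s ^+ 2 * (2 * c ^+ 2) =
    \sum_x gibbs alpha x * (s * energy beta x + s ^+ 2 * (2 * c ^+ 2)).
  rewrite mulr_sumr -[X in _ + X]mul1r -[X in X * (_ * _)]g1 mulr_suml -big_split /=.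
  by apply: eq_bigr => x _; ring.
apply: ler_sum => x _; rewrite ler_wpM2l //.
have := ec x; rewrite ler_norml => ecx.
have h : expR (s * energy beta x) <=
    1 + s * energy beta x + 2 * (s * energy beta x) ^+ 2.
  by apply: expR_le_quad; nra.
have : (s * energy beta x) ^+ 2 <= s ^+ 2 * c ^+ 2.
  by rewrite exprMn ler_wpM2l ?sqr_ge0 //; nra.
lra.
Qed.

Section KKT.
Variables (lo hi : I -> R).

Definition feasible alpha :=
  (forall i, lo i <= alpha i <= hi i) /\ \sum_i alpha i = 1.

(** The feasible set is closed in a product of segments, hence compact by Tychonoff, and the
    objective is continuous in the product topology. *)
Lemma feasible_max (d : I -> R) : (exists alpha, feasible alpha) ->
  exists2 alpha, feasible alpha & forall beta, feasible beta ->
    - logZ beta - \sum_i beta i * d i <= - logZ alpha - \sum_i alpha i * d i.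
Proof.
move=> [a0 fa0].
pose T := prod_topology (fun _ : I => R : topologicalType).
pose box : set T := [set f | forall i, (fun i => `[lo i, hi i]%classic) i (f i)].
have projc i : continuous (fun f : T => (f : I -> R) i).
  exact: (@proj_continuous I (fun=> R) i).
have sumc (w : I -> R) : continuous (fun f : T => \sum_i (f : I -> R) i * w i).
  apply: (@continuous_bigsum R T I (fun i f => (f : I -> R) i * w i)) => i f.
  apply: (@continuousM R T (fun f : T => (f : I -> R) i) (fun=> w i)).
    exact: projc.
  exact: cst_continuous.
pose F : set T := [set f | feasible f].
have Fc : compact F.
  have -> : F = [set f : T | \sum_i (f : I -> R) i * 1 = 1] `&` box.
    apply/seteqP; split => f /=.
      move=> [fb f1]; split.
        by rewrite -[RHS]f1; apply: eq_bigr => i _; rewrite mulr1.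
      by move=> i /=; rewrite in_itv /=; exact: fb.
    move=> [f1 fb]; split; last first.
      by rewrite -[RHS]f1; apply: eq_bigr => i _; rewrite mulr1.
    by move=> i; have := fb i; rewrite /= in_itv.
  apply: (@subclosed_compact _ _ box); last 2 first.
  - by apply: tychonoff => i; exact: segment_compact.
  - exact: subIsetr.
  apply: closedI; last first.
    by apply: compact_closed; [exact: hausdorff_product|
      apply: tychonoff => i; exact: segment_compact].
  have := @preimage_closed T R (fun f : T => \sum_i (f : I -> R) i * 1) [set x | x = 1].
  apply; last exact: closed_eq.
  by move=> f _; exact: sumc.
have Gc : {within F, continuous (fun f : T => - logZ f - \sum_i (f : I -> R) i * d i)}.
  apply: continuous_subspaceT => f.
  apply: (@continuousB R R T (fun f : T => - logZ f)); last exact: sumc.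
  apply: (@continuousN R R T (fun f : T => logZ f)).
  apply: (@continuous_comp T R R (fun f : T => \sum_x expR (energy f x)));
    last by apply: continuous_ln; exact: Z_gt0.
  apply: (@continuous_bigsum R T X (fun x f => expR (energy f x))) => x {}f.
  apply: (@continuous_comp T R R (fun f : T => energy f x));
    last exact: continuous_expR.
  exact: sumc.
have [|alpha aF amax] := @compact_EVT_max T R _ F _ Fc Gc; first by exists a0.
exists alpha; first by move: aF; rewrite inE.
by move=> beta fb; apply: amax; rewrite inE.
Qed.

(* Lagrangian duality: the dual of the feasibility problem kl t (A i) <= d i is
   to maximize - logZ alpha - \sum_i alpha i * d i, and the Gibbs distribution of
   a maximizer is the primal point; linear constraints on kl t (A i) - kl t (A g)
   are obtained by letting alpha i be negative. *)
Lemma gibbs_kkt (d : I -> R) : (exists alpha, feasible alpha) ->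
  exists alpha, [/\ feasible alpha,
    forall beta, feasible beta ->
      - logZ beta - \sum_i beta i * d i <= - logZ alpha - \sum_i alpha i * d i &
    forall beta, feasible beta ->
      \sum_i beta i * (kl (gibbs alpha) (A i) - d i) <=
      - logZ alpha - \sum_i alpha i * d i].
Proof.
move=> /feasible_max-/(_ d)[alpha fa amax]; exists alpha; split => // beta fb.
pose z i := kl (gibbs alpha) (A i) - d i.
have -> : - logZ alpha - \sum_i alpha i * d i = \sum_i alpha i * z i.
  have := gibbs_variational (gibbs_distr alpha) fa.2.
  rewrite klxx sub0r => <-; rewrite -sumrB.
  by apply: eq_bigr => i _; rewrite /z; ring.
rewrite -subr_ge0 -sumrB.
(* The segment from [alpha] to [beta] stays feasible. Maximality along it bounds the first-order
   change from below, up to the quadratic remainder of [logZ_le]. *)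
pose D i := beta i - alpha i.
have D0 : \sum_i D i = 0 by rewrite sumrB fa.2 fb.2 subrr.
pose c := 1 + \sum_x `|energy D x|.
have Dc x : `|energy D x| <= c.
  rewrite /c (bigD1 x) //= addrCA lerDl addr_ge0 //; exact: sumr_ge0.
have c1 : 1 <= c by rewrite /c lerDl; exact: sumr_ge0.
have DzE : \sum_i (alpha i * z i - beta i * z i) =
    \sum_x gibbs alpha x * energy D x + \sum_i D i * d i.
  have -> : \sum_x gibbs alpha x * energy D x =
      \sum_i D i * (\sum_x gibbs alpha x * ln (A i x)).
    rewrite /energy; under eq_bigr do rewrite mulr_sumr.
    rewrite exchange_big /=; apply: eq_bigr => i _.
    by rewrite mulr_sumr; apply: eq_bigr => x _; ring.
  have zE i : z i = \sum_x gibbs alpha x * ln (gibbs alpha x) -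
      \sum_x gibbs alpha x * ln (A i x) - d i.
    rewrite /z /kl -sumrB; congr (_ - _); apply: eq_bigr => x _; ring.
  have -> : \sum_i (alpha i * z i - beta i * z i) = - \sum_i D i * z i.
    by rewrite -sumrN; apply: eq_bigr => i _; rewrite /D; ring.
  have -> : \sum_i D i * z i =
    (\sum_i D i) * (\sum_x gibbs alpha x * ln (gibbs alpha x)) -
     \sum_i D i * (\sum_x gibbs alpha x * ln (A i x)) - \sum_i D i * d i.
    rewrite mulr_suml -!sumrB; apply: eq_bigr => i _; rewrite zE; ring.
  rewrite D0; ring.
apply: (@slope_ge0 _ _ (2 * c ^+ 2) (2 * c)^-1).
- by rewrite invr_gt0; lra.
- by rewrite mulr_ge0 // sqr_ge0.
move=> s /andP[s0 s1]; rewrite DzE.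
have sc : s * c <= 1 / 2.
  by move: s1; rewrite -ler_pdivlMr ?invrM ?unitfE; lra.
have sle1 : s <= 1 by nra.
have := logZ_le alpha (ltW s0) Dc sc.
have := amax (fun i => alpha i + s * D i).
have -> : \sum_i (alpha i + s * D i) * d i =
    \sum_i alpha i * d i + s * \sum_i D i * d i.
  by rewrite mulr_sumr -big_split /=; apply: eq_bigr => i _; ring.
have : feasible (fun i => alpha i + s * D i).
  split; last by rewrite big_split /= -mulr_sumr D0 mulr0 addr0 fa.2.
  by move=> i; have := fa.1 i; have := fb.1 i; rewrite /D; nra.
move=> fs /(_ fs); lra.
Qed.
End KKT.
End Gibbs.

(** * Transfer of types between the two families *)

Section Transfer.
Variables (R : realType) (I X Y : finType) (A : I -> X -> R) (B : I -> Y -> R).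
Hypothesis A_distr : forall i, distr (A i).
Hypothesis A_gt0 : forall i x, 0 < A i x.
Hypothesis X_gt0 : (0 < #|X|)%N.
Hypothesis B_distr : forall i, distr (B i).
Hypothesis B_gt0 : forall i y, 0 < B i y.
Hypothesis Y_gt0 : (0 < #|Y|)%N.

Let e_ (g i : I) : R := (i == g)%:R.

Let sum_e g (f : I -> R) : \sum_i e_ g i * f i = f g.
Proof.
rewrite (bigD1 g) //= /e_ eqxx mul1r big1 ?addr0 // => i /negbTE ->.
by rewrite mul0r.
Qed.

Let sum_e1 g : \sum_i e_ g i = 1.
Proof. by rewrite -[RHS](sum_e g (fun=> 1)); apply: eq_bigr => i _; rewrite mulr1. Qed.

Lemma logZ_vertex (Z : finType) (C : I -> Z -> R) g : (forall i, distr (C i)) ->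
  (forall i x, 0 < C i x) -> logZ C (fun i => (i == g)%:R) = 0.
Proof.
move=> C1 C0; rewrite /logZ -[RHS]ln1 -[in RHS](C1 g).2; congr ln; apply: eq_bigr => x _.
by rewrite [energy _ _ _](sum_e g (fun i => ln (C i x))) lnK ?posrE.
Qed.

(** The cone of weights is unbounded, so it is truncated at [- M]. The slack [eta] makes the optimal
    value at most [eta * (1 - alpha g)], while the vertex at [g] shows that it is at least
    [- kl s (B g)]. Hence [alpha g <= M], and every [alpha i] can still be lowered by 1 inside the
    box. *)
Lemma pull_type (s : Y -> R) (g : I) (eta : R) : 0 < eta -> distr s ->
  (forall alpha, (forall i, i != g -> alpha i <= 0) -> \sum_i alpha i = 1 ->
     logZ B alpha <= logZ A alpha) ->
  exists t : X -> R, [/\ distr t, forall x, 0 < t x,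
    kl t (A g) <= kl s (B g) &
    forall i, kl s (B i) - kl s (B g) - eta <= kl t (A i) - kl t (A g)].
Proof.
move=> eta0 sd AB.
pose M := kl s (B g) / eta + 1.
have kl0 : 0 <= kl s (B g) by apply: kl_ge0.
have M1 : 1 <= M by rewrite /M lerDr divr_ge0 // ltW.
pose lo i : R := if i == g then 1 else - M.
pose hi i : R := if i == g then 1 + M else 0.
pose d i := kl s (B i) - (if i == g then 0 else eta).
have fe : feasible lo hi (e_ g).
  split; last exact: sum_e1.
  by move=> i; rewrite /lo /hi /e_; case: eqP => _ /=; lra.
have [|alpha [fa amax kkt]] :=
  gibbs_kkt A X_gt0 (lo := lo) (hi := hi) d; first by exists (e_ g).
have G_le : - logZ A alpha - \sum_i alpha i * d i <= eta * (1 - alpha g).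
  have -> : eta * (1 - alpha g) =
      \sum_i alpha i * kl s (B i) - \sum_i alpha i * d i.
    rewrite -sumrB (bigD1 g) //= {1}/d eqxx subr0 subrr add0r.
    have -> : 1 - alpha g = \sum_(i | i != g) alpha i.
      by rewrite -fa.2 (bigD1 g) //= addrAC subrr add0r.
    rewrite mulr_sumr.
    apply: eq_bigr => i /negbTE ig; rewrite /d ig; ring.
  rewrite lerD2r (gibbs_variational B sd fa.2).
  have := @kl_ge0 _ _ _ _ sd (gibbs_distr B Y_gt0 alpha) (gibbs_gt0 B alpha).
  have := AB alpha; rewrite fa.2 => /(_ _ erefl) h.
  have {}h : logZ B alpha <= logZ A alpha.
    by apply: h => i /negbTE ig; have := fa.1 i; rewrite /hi ig => /andP[].
  lra.
have G_ge := amax _ fe.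
rewrite sum_e (logZ_vertex g A_distr A_gt0 : logZ A (e_ g) = 0) /d eqxx in G_ge.
have ag : alpha g <= M.
  have : eta * (alpha g - 1) <= kl s (B g) by lra.
  by rewrite mulrC -ler_pdivlMr // /M; lra.
have ag1 : 1 <= alpha g by have := fa.1 g; rewrite /lo eqxx => /andP[].
exists (gibbs A alpha); split; [exact: gibbs_distr|exact: gibbs_gt0| |].
  have := kkt _ fe; rewrite sum_e {1}/d eqxx; nra.
move=> i; have [->|ig] := eqVneq i g; first lra.
have GE : - logZ A alpha - \sum_i alpha i * d i =
    \sum_i alpha i * (kl (gibbs A alpha) (A i) - d i).
  have := gibbs_variational A (gibbs_distr A X_gt0 alpha) fa.2.
  rewrite klxx sub0r => <-; rewrite -sumrB.
  by apply: eq_bigr => j _; ring.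
(* Shifting one unit of weight from [i] to [g] turns the optimality condition into the constraint on
   the difference at [i]. *)
have fb : feasible lo hi (fun j => alpha j + e_ g j - e_ i j).
  split; last by rewrite sumrB big_split /= !sum_e1 fa.2; ring.
  have ai : - alpha i <= M - 1.
    have : \sum_(j | j != g) - alpha j = alpha g - 1.
      rewrite sumrN -fa.2 [X in _ = _ - X](bigD1 g) //=; lra.
    rewrite (bigD1 i) //= => E.
    have : 0 <= \sum_(j | (j != g) && (j != i)) - alpha j.
      apply: sumr_ge0 => j /andP[/negbTE jg _].
      by have := fa.1 j; rewrite /hi jg oppr_ge0 => /andP[].
    lra.
  move=> j; have := fa.1 j; rewrite /lo /hi /e_.
  have [->|jg] := eqVneq j g.
    by rewrite eq_sym (negbTE ig) /=; lra.
  by have [->|ji] := eqVneq j i => /=; lra.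
have := kkt _ fb; rewrite GE.
have -> : \sum_j (alpha j + e_ g j - e_ i j) * (kl (gibbs A alpha) (A j) - d j) =
    \sum_j alpha j * (kl (gibbs A alpha) (A j) - d j) +
    (kl (gibbs A alpha) (A g) - d g) - (kl (gibbs A alpha) (A i) - d i).
  rewrite -(sum_e g (fun j => kl (gibbs A alpha) (A j) - d j)).
  rewrite -(sum_e i (fun j => kl (gibbs A alpha) (A j) - d j)).
  rewrite -big_split -sumrB; apply: eq_bigr => j _ /=; ring.
rewrite /d eqxx (negbTE ig); lra.
Qed.

(** The weights range over a compact simplex, so the duality holds without slack, and each vertex of
    the simplex yields one constraint. *)
Lemma push_type (t : X -> R) (g : I) : distr t ->
  (forall alpha, (forall i, 0 <= alpha i <= 1) -> \sum_i alpha i = 1 ->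
     logZ A alpha <= logZ B alpha) ->
  exists s : Y -> R, [/\ distr s, forall y, 0 < s y &
    forall i, kl s (B i) <= kl t (A i)].
Proof.
move=> td AB.
pose d i := kl t (A i).
have fe i : feasible (fun=> 0) (fun=> 1) (e_ i).
  by split; [move=> j; rewrite /e_; case: eqP => _ /=; lra|exact: sum_e1].
have [|alpha [fa _ kkt]] := gibbs_kkt B Y_gt0
  (lo := fun=> 0) (hi := fun=> 1) d; first by exists (e_ g).
exists (gibbs B alpha); split; [exact: gibbs_distr|exact: gibbs_gt0|move=> i].
have := kkt _ (fe i); rewrite sum_e.
have := gibbs_variational A td fa.2; rewrite -/d.
have := @kl_ge0 _ _ _ _ td (gibbs_distr A X_gt0 alpha) (gibbs_gt0 A alpha).
have := AB _ fa.1 fa.2; rewrite /d; lra.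
Qed.
End Transfer.

(** * Method of types *)

Section Coarsening.
Variables (R : realType) (I : finType) (P : mfamily R I) (C : finType).
Variable f : carrier P -> C.

(** Only attained values are kept, so that every merged row has positive mass. *)
Let D := {c : C | c \in codom f}.

Let fiber_gt0 i (c : D) : 0 < \sum_(x | f x == val c) mass i x.
Proof.
have /codomP[x cE] := valP c.
rewrite (bigD1 x) /=; last by rewrite cE.
rewrite ltr_pwDl ?mass_gt0 //; apply: sumr_ge0 => y _; exact: ltW (mass_gt0 _ _).
Qed.

Definition coarsen : mfamily R I :=
  @MFamily R I D (fun i c => \sum_(x | f x == val c) mass i x) fiber_gt0.

Let cls x : D := exist _ (f x) (codom_f f x).

Lemma sum_fibers (F : carrier P -> R) :
  \sum_(c : D) \sum_(x | f x == val c) F x = \sum_x F x.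
Proof.
by rewrite [RHS](partition_big cls xpredT).
Qed.

Lemma coarsen_probability : is_probability P -> is_probability coarsen.
Proof. by move=> P1 i; rewrite -(P1 i) -sum_fibers. Qed.

Lemma majorizes_coarsen : majorizes P coarsen.
Proof.
exists (fun (c : D) x => (f x == val c)%:R); split; first split => //.
- move=> x; rewrite (bigD1 (cls x)) //= eqxx big1 ?addr0 // => c.
  by rewrite -val_eqE /= eq_sym => /negbTE ->.
- move=> i c /=; rewrite big_mkcond; apply: eq_bigr => x _.
  by case: eqP => _; rewrite ?mul1r ?mul0r.
Qed.

(** Splitting each class uniformly undoes the merging under all hypotheses at once, because the rows
    in a class coincide. *)
Lemma coarsen_majorizes : (forall i x y, f x = f y -> mass i x = mass i y) ->
  majorizes coarsen P.
Proof.
move=> fm; pose n (c : D) := #|[pred x | f x == val c]|.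
have n0 c : (n c)%:R != 0 :> R.
  rewrite pnatr_eq0 -lt0n; apply/card_gt0P.
  by have /codomP[x cE] := valP c; exists x; rewrite inE cE.
exists (fun x (c : D) => if f x == val c then (n c)%:R^-1 else 0).
split; first split.
- by move=> x c; case: ifP.
- move=> c; rewrite -big_mkcond /= sumr_const -[_ *+ _]mulr_natl (_ : #|_| = n c).
    by rewrite divff.
  by apply: eq_card => x; rewrite !inE.
- move=> i x; rewrite (bigD1 (cls x)) //= eqxx [X in _ + X]big1 ?addr0; last first.
    by move=> c; rewrite -val_eqE /= eq_sym => /negbTE ->; rewrite mul0r.
  rewrite (eq_bigr (fun=> mass i x)); last by move=> y /eqP /fm.
  rewrite sumr_const -[mass i x *+ _]mulr_natl mulrA (_ : #|_| = n (cls x)).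
    by rewrite mulVf ?mul1r.
  by apply: eq_card => y; rewrite !inE.
Qed.
End Coarsening.

Section Types.
Variables (R : realType) (I : finType) (A : mfamily R I).
Local Notation X := (carrier A).
Local Notation power := (tensor_exp A).

Fixpoint occ N : carrier (power N) -> X -> nat :=
  match N return carrier (power N) -> X -> nat with
  | 0 => fun _ _ => 0%N
  | N'.+1 => fun z a => ((z.1 == a) + occ z.2 a)%N
  end.

Lemma sum_occ N (z : carrier (power N)) : (\sum_a occ z a)%N = N.
Proof.
elim: N z => [|N IH] z /=; first by rewrite big1.
rewrite big_split /= IH (bigD1 z.1) //= eqxx big1 ?addn0 // => a /negbTE.
by rewrite eq_sym => ->.
Qed.

Lemma occ_le N (z : carrier (power N)) a : (occ z a <= N)%N.
Proof. by rewrite -[leqRHS](sum_occ z) (bigD1 a) //= leq_addr. Qed.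

Let prod_occ N (w : X -> R) (z : carrier (power N.+1)) :
  \prod_a w a ^+ occ z a = w z.1 * \prod_a w a ^+ occ (z.2 : carrier (power N)) a.
Proof.
rewrite /= (eq_bigr _ (fun a _ => exprD (w a) _ _)) big_split /=; congr (_ * _).
rewrite (bigD1 z.1) //= eqxx expr1 big1 ?mulr1 // => a /negbTE.
by rewrite eq_sym => ->; rewrite expr0.
Qed.

Lemma mass_power N i (z : carrier (power N)) :
  mass i z = \prod_a mass i a ^+ occ z a.
Proof.
elim: N z => [|N IH] z; first by rewrite /= big1.
by rewrite prod_occ -IH.
Qed.

Lemma sum_power N (w : X -> R) :
  \sum_(z : carrier (power N)) \prod_a w a ^+ occ z a = (\sum_a w a) ^+ N.
Proof.
elim: N => [|N IH].
  rewrite expr0 (eq_bigr (fun=> 1)); last by move=> z _; rewrite big1.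
  by rewrite sumr_const card_unit.
rewrite exprS mulr_suml -IH.
rewrite -(pair_bigA _ (fun x (z : carrier (power N)) =>
  \prod_a w a ^+ @occ N.+1 (x, z) a)) /=.
apply: eq_bigr => x _; rewrite mulr_sumr; apply: eq_bigr => z _.
exact: (@prod_occ N w (x, z)).
Qed.

Lemma power_probability N : is_probability A -> is_probability (power N).
Proof.
move=> A1 i; under eq_bigr do rewrite mass_power.
by rewrite sum_power A1 expr1n.
Qed.

Definition type N (z : carrier (power N)) : {ffun X -> 'I_N.+1} :=
  [ffun a => inord (occ z a)].

Lemma typeE N (z : carrier (power N)) a : type z a = occ z a :> nat.
Proof. by rewrite ffunE inordK // ltnS occ_le. Qed.

Definition types N : mfamily R I := coarsen (@type N).

Lemma power_majorizes_types N : majorizes (power N) (types N).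
Proof. exact: majorizes_coarsen. Qed.

Lemma types_majorizes_power N : majorizes (types N) (power N).
Proof.
apply: coarsen_majorizes => i x y xy; rewrite !mass_power.
by apply: eq_bigr => a _; rewrite -!typeE xy.
Qed.

Lemma card_types N : (#|carrier (types N)| <= N.+1 ^ #|X|)%N.
Proof.
rewrite card_sig; apply: leq_trans (max_card _) _.
by rewrite card_ffun card_ord.
Qed.

Definition freq N (c : carrier (types N)) (a : X) : R :=
  (val c a : nat)%:R / N%:R.

(** The probability that [N] independent draws from [freq c] have type [c]. It replaces the
    multinomial coefficient: it does not depend on the hypothesis and is at most 1. *)
Definition mult N (c : carrier (types N)) : R :=
  \sum_(z | type z == val c) \prod_a freq c a ^+ occ z a.

Lemma freq_distr N (c : carrier (types N)) : (0 < N)%N -> distr (freq c).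
Proof.
move=> N0; split => [a|]; first by rewrite divr_ge0.
rewrite -mulr_suml -natr_sum; have /codomP[z cE] := valP c.
rewrite cE (eq_bigr (fun a => occ z a)) ?sum_occ; last by move=> a _; rewrite typeE.
by rewrite divff // pnatr_eq0 -lt0n.
Qed.

Lemma mult_ge0 N (c : carrier (types N)) : 0 <= mult c.
Proof.
by apply: sumr_ge0 => z _; apply: prodr_ge0 => a _; rewrite exprn_ge0 // divr_ge0.
Qed.

Lemma mult_le1 N (c : carrier (types N)) : (0 < N)%N -> mult c <= 1.
Proof.
move=> N0; rewrite -(expr1n R N) -(freq_distr c N0).2 -sum_power.
rewrite [leRHS](bigID (fun z => type z == val c)) /= lerDl.
apply: sumr_ge0 => z _; apply: prodr_ge0 => a _.
by rewrite exprn_ge0 // divr_ge0.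
Qed.

Lemma class_weight N (c : carrier (types N)) (w : X -> R) : (0 < N)%N ->
  (forall a, 0 < w a) ->
  \sum_(z | type z == val c) \prod_a w a ^+ occ z a =
  mult c * expR (- (N%:R * kl (freq c) w)).
Proof.
move=> N0 w0; rewrite /mult mulr_suml; apply: eq_bigr => z /eqP zc.
rewrite /kl mulr_sumr -sumrN expR_sum -big_split /=; apply: eq_bigr => a _.
have Nn0 : N%:R != 0 :> R by rewrite pnatr_eq0 -lt0n.
have cE : (val c a : nat) = occ z a by rewrite -zc typeE.
have [eq0|neq0] := eqVneq (occ z a) 0%N.
  by rewrite {2}/freq cE eq0 !expr0 mul0r mul0r mulr0 oppr0 expR0 mulr1.
have f0 : 0 < freq c a by rewrite divr_gt0 // ltr0n // cE lt0n.
rewrite [N%:R * _](_ : _ = (occ z a)%:R * (ln (freq c a) - ln (w a))); last first.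
  by rewrite mulrA {1}/freq cE; congr (_ * _); rewrite mulrC divfK.
rewrite -mulrN opprB expRM_natl -exprMn; congr (_ ^+ _).
rewrite expRD expRN !lnK ?posrE // mulrCA divff ?mulr1 // gt_eqF //.
Qed.

Lemma mass_types N i (c : carrier (types N)) : (0 < N)%N ->
  mass i c = mult c * expR (- (N%:R * kl (freq c) (mass i))).
Proof.
move=> N0; rewrite -class_weight //; last exact: mass_gt0.
by apply: eq_bigr => z _; rewrite mass_power.
Qed.

(** Pigeonhole in place of Stirling: the classes have total probability 1 under [w], far classes are
    exponentially unlikely, and if all near ones had small [mult], the total would be at most
    1/2. *)
Lemma type_near N (w : X -> R) (xi : R) : (0 < N)%N -> distr w ->
  (forall a, 0 < w a) -> 0 <= xi ->
  (N.+1 ^ #|X|)%:R * expR (- (N%:R * (xi ^+ 2 / 4))) <= 1 / 2 ->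
  exists c : carrier (types N), (forall a, `|freq c a - w a| <= xi) /\
    1 / 2 <= (N.+1 ^ #|X|)%:R * mult c.
Proof.
move=> N0 wd w0 xi0 small; set n : R := (_ ^ _)%:R.
have n0 : 0 < n by rewrite ltr0n expn_gt0.
apply: contrapT => none.
have cle (c : carrier (types N)) : mult c * expR (- (N%:R * kl (freq c) w)) <= (2 * n)^-1.
  have kl0 : 0 <= kl (freq c) w by apply: kl_ge0 => //; exact: freq_distr.
  have [near|] := pselect (forall a, `|freq c a - w a| <= xi).
    have mc : mult c < (2 * n)^-1.
      rewrite ltNge; apply/negP => h; apply: none; exists c; split => //.
      move: h; rewrite -div1r ler_pdivrMr; last by rewrite mulr_gt0.
      rewrite /n; lra.
    apply: le_trans (ltW mc); rewrite ler_piMr ?mult_ge0 //.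
    by rewrite -expR0 ler_expR oppr_le0 mulr_ge0.
  move/existsNP => [a /negP]; rewrite -ltNge => far.
  apply: le_trans (_ : expR (- (N%:R * kl (freq c) w)) <= _).
    by rewrite ler_piMl ?expR_ge0 // mult_le1.
  apply: le_trans (_ : expR (- (N%:R * (xi ^+ 2 / 4))) <= _).
    rewrite ler_expR lerN2 ler_wpM2l // ler_pdivrMr // mulrC.
    apply: le_trans (kl_ge_sq a (freq_distr c N0) wd w0).
    rewrite -(ger0_norm (sqr_ge0 (_ - _))) normrX.
    by rewrite ler_sqr ?nnegrE // ltW.
  rewrite -[leRHS]div1r ler_pdivlMr; last by rewrite mulr_gt0.
  by move: small; rewrite -/n; lra.
have : \sum_(c : carrier (types N)) mult c * expR (- (N%:R * kl (freq c) w)) = 1.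
  rewrite -[RHS](expr1n _ N) -[in RHS]wd.2 -sum_power -(sum_fibers (@type N)).
  by apply: eq_bigr => c _; rewrite class_weight.
have : \sum_(c : carrier (types N)) mult c * expR (- (N%:R * kl (freq c) w)) <=
    \sum_(c : carrier (types N)) (2 * n)^-1 by apply: ler_sum => c _.
rewrite sumr_const -[_^-1 *+ _]mulr_natl => h1 h2.
have : #|carrier (types N)|%:R <= n by rewrite ler_nat card_types.
move: h1; rewrite h2 ler_pdivlMr ?mulr_gt0 //; lra.
Qed.
End Types.

(** * Routing between types *)

Section TypeRouting.
Variables (R : realType) (I : finType) (A B : mfamily R I).
Local Notation X := (carrier A).
Local Notation Y := (carrier B).
Local Notation a := (@mass R I A).
Local Notation b := (@mass R I B).
Hypothesis A1 : is_probability A.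
Hypothesis B1 : is_probability B.
Hypothesis X_gt0 : (0 < #|X|)%N.
Hypothesis Y_gt0 : (0 < #|Y|)%N.
Hypothesis logZ_simplex : forall alpha, (forall i, 0 <= alpha i <= 1) ->
  \sum_i alpha i = 1 -> logZ a alpha <= logZ b alpha.
Hypothesis logZ_cone : forall alpha g, (forall i, i != g -> alpha i <= 0) ->
  \sum_i alpha i = 1 -> logZ b alpha <= logZ a alpha.
(* c is the error exponent of the guess, th the weight of the hypothesis mixed into
   the distributions given by duality (so that atypical rows gain the exponent
   th * z / 2), k ^+ 2 the mesh of the approximation by types, and a type is
   typical when its relative entropy is below z. *)
Variables (C c th k kap : R) (N : nat).
Local Notation m := (#|X| + #|Y|)%N.
Local Notation n := ((N.+1 ^ m)%:R : R).
Local Notation z := (kap ^+ 2 / 4).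
Local Notation K := (2 * n * expR (N%:R * (c / 4))).
Local Notation eps := (2 * n * expR (- (N%:R * (th * z / 2)))).
Hypothesis N_gt0 : (0 < N)%N.
Hypothesis lnA : forall i x, `|ln (a i x)| <= C.
Hypothesis lnB : forall i y, `|ln (b i y)| <= C.
Hypothesis C_ge0 : 0 <= C.
Hypothesis c_gt0 : 0 < c.
Hypothesis th01 : 0 <= th <= 1.
Hypothesis k01 : 0 <= k <= 1.
Hypothesis kap_ge0 : 0 <= kap.
Hypothesis k_th : m%:R * (k * (3 + C)) <= th * z / 2.
Hypothesis k_c : m%:R * (k * (3 + C)) <= c / 16.
Hypothesis th_c : 4 * th * C <= c / 16.
Hypothesis kap_c : m%:R * (kap * (2 * C)) <= c / 16.
Hypothesis near : n * expR (- (N%:R * ((k ^+ 2) ^+ 2 / 4))) <= 1 / 2.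

Let A_distr i : distr (a i).
Proof. by split=> [x|]; [exact: ltW (mass_gt0 _ _)|exact: A1]. Qed.

Let B_distr i : distr (b i).
Proof. by split=> [x|]; [exact: ltW (mass_gt0 _ _)|exact: B1]. Qed.

Let sizes_le (r s : R) : 0 <= r -> m%:R * r <= s ->
  #|X|%:R * r <= s /\ #|Y|%:R * r <= s.
Proof.
move=> r0; rewrite natrD mulrDl.
have : 0 <= #|X|%:R * r by rewrite mulr_ge0.
have : 0 <= #|Y|%:R * r by rewrite mulr_ge0.
by split; lra.
Qed.

Let near_type (F : mfamily R I) (w : carrier F -> R) : (#|carrier F| <= m)%N ->
  distr w -> (forall x, 0 < w x) ->
  exists j : carrier (types F N), (forall x, `|freq j x - w x| <= k ^+ 2) /\
    (2 * n)^-1 <= mult j.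
Proof.
move=> Fm wd w0.
have Fn : (N.+1 ^ #|carrier F|)%:R <= n :> R by rewrite ler_nat leq_pexp2l.
have [|j [jw jm]] := type_near N_gt0 wd w0 (sqr_ge0 k).
  by apply: le_trans near; rewrite ler_wpM2r ?expR_ge0.
exists j; split => //; rewrite -div1r ler_pdivrMr; last first.
  by rewrite mulr_gt0 // ltr0n expn_gt0.
have : (N.+1 ^ #|carrier F|)%:R * mult j <= n * mult j.
  by rewrite ler_wpM2r ?mult_ge0.
lra.
Qed.

Let n_gt0 : 0 < n. Proof. by rewrite ltr0n expn_gt0. Qed.

Let weight_le (F H : mfamily R I) i (g : carrier (types F N))
    (h : carrier (types H N)) (s : R) :
  (2 * n)^-1 <= mult h ->
  kl (freq h) (@mass R I H i) - kl (freq g) (@mass R I F i) <= s ->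
  mass i g <= 2 * n * expR (N%:R * s) * mass i h.
Proof.
move=> hm hs; rewrite !mass_types //.
apply: le_trans (_ : 1 * expR (- (N%:R * kl (freq g) (@mass R I F i))) <= _).
  by rewrite ler_wpM2r ?expR_ge0 // mult_le1.
rewrite mulrACA ler_pM ?expR_ge0 //.
  by move: hm; rewrite -div1r ler_pdivrMr ?mulr_gt0 // mulrC.
rewrite -expRD ler_expR -mulrN -mulrN -mulrDr ler_wpM2l //; lra.
Qed.

(** Mixing [b g] into [s] scales the bound on the entropy relative to [b g] by [1 - th], since
    [kl (b g) (b g) = 0]. A far type thereby gains [th * z], of which rounding consumes at most
    half. *)
Lemma push_level g (j : carrier (types A N)) : exists l : carrier (types B N),
  (forall i, mass i j <= K * mass i l) /\
  (z <= kl (freq j) (a g) -> mass g j <= eps * mass g l).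
Proof.
have [[th0 th1] [k0 k1] cp C0] : [/\ 0 <= th /\ th <= 1, 0 <= k /\ k <= 1, 0 < c & 0 <= C].
  by split => //; [case/andP: th01|case/andP: k01].
have kth := k_th; have kc := k_c; have thc := th_c; have kapc := kap_c.
have jd := freq_distr j N_gt0.
have [s [sd s0 sk]] := push_type X_gt0 Y_gt0 g jd logZ_simplex.
pose s' y := (1 - th) * s y + th * b g y.
have s'd : distr s' by apply: distr_mix.
have s'0 y : 0 < s' y.
  have h1 : 0 <= (1 - th) * s y by rewrite mulr_ge0 ?(ltW (s0 _)) //; lra.
  have h2 : 0 <= th * b g y by rewrite mulr_ge0 ?(ltW (mass_gt0 _ _)) //; lra.
  have [t0|t0] := eqVneq th 0; first by rewrite /s' t0 subr0 mul1r mul0r addr0.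
  have : 0 < th * b g y by rewrite mulr_gt0 ?mass_gt0 // lt_def t0; lra.
  by rewrite /s'; lra.
have [l [ls' lm]] := near_type (leq_addl _ _) s'd s'0.
have ld := freq_distr l N_gt0.
have C3 : 0 <= k * (3 + C) by rewrite mulr_ge0; lra.
have kln i : kl (freq l) (b i) <= kl s' (b i) + #|Y|%:R * (k * (3 + C)).
  exact: kl_near.
have mixi i := kl_mix (b i) th01 sd (B_distr g).
have klC i : kl (b g) (b i) <= C.
  by apply: kl_le => // y; have := lnB i y; rewrite ler_norml => /andP[].
have kls i : 0 <= kl s (b i) by apply: kl_ge0 => //; exact: mass_gt0.
exists l; split => [i|far].
  apply: weight_le => //.
  have [_ h] := sizes_le C3 kc; have := kln i; have := mixi i; rewrite -/s'.
  have : 0 <= th * kl s (b i) by rewrite mulr_ge0.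
  have : th * kl (b g) (b i) <= th * C by rewrite ler_wpM2l.
  have := sk i; lra.
rewrite -mulrN; apply: weight_le => //.
have [_ h] := sizes_le C3 kth; have := kln g; have := mixi g.
rewrite klxx -/s'.
have : (1 - th) * kl s (b g) <= (1 - th) * kl (freq j) (a g).
  by rewrite ler_wpM2l // subr_ge0.
have : th * z <= th * kl (freq j) (a g) by rewrite ler_wpM2l.
lra.
Qed.

(** Here the exponent [c / 4] of [K] is spent in full: [c / 16] on the slack of [pull_type],
    [c / 16] on mixing, and [c / 8] on rounding to a type. *)
Lemma pull_level g (l : carrier (types B N)) : exists j : carrier (types A N),
  (forall i, mass g l * mass i j <= K * (mass i l * mass g j)) /\
  (z <= kl (freq l) (b g) -> mass g l <= eps * mass g j).
Proof.
have [[th0 th1] [k0 k1] cp C0] : [/\ 0 <= th /\ th <= 1, 0 <= k /\ k <= 1, 0 < c & 0 <= C].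
  by split => //; [case/andP: th01|case/andP: k01].
have kth := k_th; have kc := k_c; have thc := th_c; have kapc := kap_c.
have ld := freq_distr l N_gt0.
have c16 : 0 < c / 16 by lra.
have [t [td t0 tg ti]] := pull_type A_distr (@mass_gt0 R I A) X_gt0
  B_distr (@mass_gt0 R I B) Y_gt0 c16 ld (fun al => @logZ_cone al g).
pose t' x := (1 - th) * t x + th * a g x.
have t'd : distr t' by apply: distr_mix.
have t'0 x : 0 < t' x.
  have h1 : 0 <= (1 - th) * t x by rewrite mulr_ge0 ?(ltW (t0 _)) //; lra.
  have h2 : 0 <= th * a g x by rewrite mulr_ge0 ?(ltW (mass_gt0 _ _)) //; lra.
  have [e0|e0] := eqVneq th 0; first by rewrite /t' e0 subr0 mul1r mul0r addr0.
  have : 0 < th * a g x by rewrite mulr_gt0 ?mass_gt0 // lt_def e0; lra.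
  by rewrite /t'; lra.
have [j [jt' jm]] := near_type (leq_addr _ _) t'd t'0.
have jd := freq_distr j N_gt0.
have C3 : 0 <= k * (3 + C) by rewrite mulr_ge0; lra.
have klt : 0 <= kl t (a g) by apply: kl_ge0 => //; exact: mass_gt0.
exists j; split => [i|far]; last first.
  rewrite -mulrN; apply: weight_le => //.
  have : kl (freq j) (a g) <= kl t' (a g) + #|X|%:R * (k * (3 + C)).
    exact: kl_near.
  have [h _] := sizes_le C3 kth; have := kl_mix (a g) th01 td (A_distr g).
  rewrite klxx -/t'.
  have : (1 - th) * kl t (a g) <= (1 - th) * kl (freq l) (b g).
    by rewrite ler_wpM2l // subr_ge0.
  have : th * z <= th * kl (freq l) (b g) by rewrite ler_wpM2l.
  lra.
rewrite !mass_types //; set ml := mult l; set mj := mult j.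
have mlj : 0 <= ml * mj by rewrite mulr_ge0 ?mult_ge0.
rewrite [leLHS]mulrACA [X in _ <= _ * X]mulrACA.
rewrite -!expRD mulrCA ler_wpM2l //.
apply: le_trans (_ : expR (N%:R * (c / 4) + (- (N%:R * kl (freq l) (b i)) -
    N%:R * kl (freq j) (a g))) <= _); last first.
  rewrite !expRD ler_wpM2r ?mulr_ge0 ?expR_ge0 // ler_peMl ?expR_ge0 //.
  have : 1 <= n by rewrite ler1n expn_gt0.
  lra.
rewrite ler_expR -!mulrN -!mulrDr ler_wpM2l //.
have := @kl_diff_near _ _ t' (freq j) (a i) (a g) (k ^+ 2) C (lnA i) (lnA g).
move=> /(_ (fun x => _)) => nd.
have {nd} : kl t' (a i) - kl t' (a g) <=
    kl (freq j) (a i) - kl (freq j) (a g) + #|X|%:R * (k ^+ 2 * (2 * C)).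
  by apply: nd => x; rewrite distrC.
have := kl_diff_mix th t (a g) (a i) (a g); rewrite -/t' => ->.
have := kl_diff_bound td (lnA i) (lnA g).
have := kl_diff_bound (A_distr g) (lnA i) (lnA g).
rewrite !ler_norml => /andP[v1 v2] /andP[u1 u2]; have := ti i.
have [h _] := sizes_le C3 kc.
have : #|X|%:R * (k ^+ 2 * (2 * C)) <= 2 * (#|X|%:R * (k * (3 + C))).
  rewrite [leRHS]mulrCA ler_wpM2l //.
  have : k ^+ 2 * C <= k * C by rewrite ler_wpM2r // expr2 ler_piMl.
  lra.
move: (kl t (a i) - kl t (a g)) (kl (a g) (a i) - kl (a g) (a g)) v1 v2 u1 u2.
move=> u v v1 v2 u1 u2.
have : th * u <= th * (2 * C) by rewrite ler_wpM2l.
have : - (th * (2 * C)) <= th * v by rewrite -mulrN ler_wpM2l.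
lra.
Qed.

(** Applied to [b g] itself, [pull_type] can only return [a g], so the relative entropies between
    hypotheses of [A] dominate those of [B] up to [c / 16]. By [kl_ge_sq], typical types lie within
    [kap] of the hypothesis and inherit this. *)
Lemma cross_level g (j : carrier (types A N)) (l : carrier (types B N)) i :
  kl (freq j) (a g) < z -> kl (freq l) (b g) < z ->
  mass g l * mass i j <= K * (mass i l * mass g j).
Proof.
move=> jz lz.
have [[th0 th1] [k0 k1] cp C0] : [/\ 0 <= th /\ th <= 1, 0 <= k /\ k <= 1, 0 < c & 0 <= C].
  by split => //; [case/andP: th01|case/andP: k01].
have kth := k_th; have kc := k_c; have thc := th_c; have kapc := kap_c.
have ld := freq_distr l N_gt0.
have jd := freq_distr j N_gt0.
have near_of (Z : finType) (t w : Z -> R) : distr t -> distr w ->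
    (forall x, 0 < w x) -> kl t w < z -> forall x, `|t x - w x| <= kap.
  move=> td wd w0 tz x; rewrite -ler_sqr ?nnegrE // real_normK ?num_real //.
  by apply: le_trans (kl_ge_sq x td wd w0) _; lra.
have c16 : 0 < c / 16 by lra.
have [t [td t0 tg ti]] := pull_type A_distr (@mass_gt0 R I A) X_gt0
  B_distr (@mass_gt0 R I B) Y_gt0 c16 (B_distr g) (fun al => @logZ_cone al g).
rewrite klxx in tg.
have tE : t = a g by apply: kl_eq0 tg => //; exact: mass_gt0.
have {ti} := ti i; rewrite tE !klxx => ti.
have C2 : 0 <= kap * (2 * C) by rewrite mulr_ge0 //; lra.
have [hX hY] := sizes_le C2 kap_c.
have dj : kl (a g) (a i) - kl (a g) (a g) <=
    kl (freq j) (a i) - kl (freq j) (a g) + #|X|%:R * (kap * (2 * C)).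
  apply: kl_diff_near => // x; rewrite distrC.
  by apply: near_of => //; exact: mass_gt0.
have dl : kl (freq l) (b i) - kl (freq l) (b g) <=
    kl (b g) (b i) - kl (b g) (b g) + #|Y|%:R * (kap * (2 * C)).
  by apply: kl_diff_near => // x; apply: near_of => //; exact: mass_gt0.
rewrite !klxx in dj dl.
rewrite !mass_types //; set ml := mult l; set mj := mult j.
have mlj : 0 <= ml * mj by rewrite mulr_ge0 ?mult_ge0.
rewrite [leLHS]mulrACA [X in _ <= _ * X]mulrACA.
rewrite -!expRD mulrCA ler_wpM2l //.
apply: le_trans (_ : expR (N%:R * (c / 4) + (- (N%:R * kl (freq l) (b i)) -
    N%:R * kl (freq j) (a g))) <= _); last first.
  rewrite !expRD ler_wpM2r ?mulr_ge0 ?expR_ge0 // ler_peMl ?expR_ge0 //.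
  have : 1 <= n by rewrite ler1n expn_gt0.
  lra.
rewrite ler_expR -!mulrN -!mulrDr ler_wpM2l //; lra.
Qed.

Lemma types_routing (V : mfamily R I) (gam : carrier V -> I) :
  is_probability V ->
  (forall g i, g != i -> \sum_(x | gam x == g) mass i x <= expR (- (N%:R * c))) ->
  n * eps <= 1 / 100 ->
  #|I|%:R * (K * (n + 4) * expR (- (N%:R * c))) <= 1 / 100 ->
  majorizes (tensor V (types A N)) (types B N).
Proof.
move=> V1 guess heps hdelta.
have cp := c_gt0.
have [r rP] := choice (fun gj => push_level gj.1 gj.2).
have [t tP] := choice (fun gl => pull_level gl.1 gl.2).
have eps0 : 0 <= eps by rewrite mulr_ge0 ?expR_ge0.
have card_le (F : mfamily R I) : (#|carrier F| <= m)%N ->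
    #|carrier (types F N)|%:R <= n.
  move=> Fm; rewrite ler_nat; apply: leq_trans (card_types F N) _.
  exact: leq_pexp2l.
have K1 : 1 <= K.
  have n2 : 1 <= 2 * n.
    have : 1 <= n by rewrite ler1n expn_gt0.
    lra.
  rewrite -[leLHS]mulr1 ler_pM //.
    by rewrite -[leLHS]expR0 ler_expR mulr_ge0 // divr_ge0 // ltW.
apply: (@routing_majorizes R I (types A N) (types B N) V gam
  (fun g j => kl (freq j) (a g) < z) (fun g l => kl (freq l) (b g) < z)
  (fun g j => r (g, j)) (fun g l => t (g, l)) K eps (expR (- (N%:R * c)))) => //.
- exact/coarsen_probability/power_probability.
- exact/coarsen_probability/power_probability.
- by apply: le_trans heps; rewrite ler_wpM2r // card_le // leq_addr.
- by apply: le_trans heps; rewrite ler_wpM2r // card_le // leq_addl.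
- apply: le_trans hdelta; rewrite ler_wpM2l // ler_wpM2r ?expR_ge0 //.
  by rewrite ler_wpM2l ?(le_trans ler01 K1) // lerD2r card_le // leq_addr.
- by move=> g j _; case: (rP (g, j)).
- by move=> g j; rewrite -leNgt; case: (rP (g, j)).
- by move=> g l _; case: (tP (g, l)).
- by move=> g l; rewrite -leNgt; case: (tP (g, l)).
- by move=> g j l jz lz i; exact: cross_level.
Qed.
End TypeRouting.

Lemma scale_small {R : realType} (M s : R) : 0 <= M -> 0 < s ->
  exists t, 0 < t <= 1 /\ M * t <= s.
Proof.
move=> M0 s0; exists (Num.min 1 (s / (M + 1))); split.
  by rewrite lt_min ltr01 /= ge_min lexx divr_gt0 //; lra.
have t0 : Num.min 1 (s / (M + 1)) <= s / (M + 1) by rewrite ge_min lexx orbT.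
apply: le_trans (ler_wpM2l M0 t0) _.
by rewrite mulrCA ler_piMr ?(ltW s0) // ler_pdivrMr; lra.
Qed.

(** The exponent is cut into [p.+1] equal parts, each of whose exponentials is at least
    [s * N.+1%:R]; the surplus factor outgrows [C]. *)
Lemma poly_le_expR {R : realType} (p : nat) (a C : R) : 0 < a -> 0 <= C ->
  exists N0, forall N, (N0 <= N)%N ->
    C * (N.+1 ^ p)%:R * expR (- (N%:R * a)) <= 1.
Proof.
move=> a0 C0; pose a' := a / p.+1%:R.
have a'0 : 0 < a' by rewrite divr_gt0.
pose s := Num.min 1 a'.
have s0 : 0 < s by rewrite lt_min ltr01.
have [s1 sa] : s <= 1 /\ s <= a' by rewrite !ge_min lexx; split => //; rewrite lexx orbT.
exists (Num.Def.archi_bound (C / s ^+ p.+1)) => N NN.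
rewrite expRN ler_pdivrMr ?expR_gt0 // mul1r natrX.
have -> : N%:R * a = p.+1%:R * (N%:R * a') 
  by rewrite mulrCA /a' [p.+1%:R * _]mulrC divfK ?pnatr_eq0.
rewrite expRM_natl.
have h1 : s * N.+1%:R <= expR (N%:R * a').
  apply: le_trans (expR_ge1Dx _); rewrite -natr1 mulrDr mulr1 addrC.
  by rewrite lerD // mulrC ler_wpM2l.
apply: le_trans (_ : (s * N.+1%:R) ^+ p.+1 <= _); last first.
  by rewrite lerXn2r ?nnegrE ?expR_ge0 // mulr_ge0 // ltW.
rewrite exprMn [N.+1%:R ^+ p.+1]exprS mulrA ler_wpM2r ?exprn_ge0 //.
rewrite mulrC -ler_pdivrMr ?exprn_gt0 //.
have := archi_boundP (divr_ge0 C0 (exprn_ge0 p.+1 (ltW s0))) => /ltW h.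
by apply: le_trans h _; rewrite ler_nat; exact: leqW.
Qed.

(** * Identifying the hypothesis *)

Section Noise.
Variables (R : realType) (I : finType).
Implicit Types U : mfamily R I.

(** The Bhattacharyya coefficient. It is multiplicative under tensor powers, and equals 1 minus half
    the squared Hellinger distance for probability families. *)
Definition overlap U i g := \sum_x Num.sqrt (mass i x * @mass R I U g x).

Lemma overlap_exp U i g N : overlap (tensor_exp U N) i g = overlap U i g ^+ N.
Proof.
elim: N => [|N IH].
  rewrite /overlap (eq_bigr (fun=> 1)); last by move=> x _; rewrite mulr1 sqrtr1.
  by rewrite sumr_const card_unit.
rewrite exprS -IH {1}/overlap /=.
rewrite -(pair_bigA _ (fun x y =>
  Num.sqrt (mass i x * mass i y * (mass g x * mass g y)))) /= mulr_suml.
apply: eq_bigr => x _; rewrite mulr_sumr; apply: eq_bigr => y _.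
by rewrite mulrACA sqrtrM // mulr_ge0 // ltW // mass_gt0.
Qed.

Lemma overlap_lt1 U i g : is_probability U ->
  (exists x, @mass R I U i x <> mass g x) -> overlap U i g < 1.
Proof.
move=> U1 [x xd].
pose d y := (Num.sqrt (@mass R I U i y) - Num.sqrt (mass g y)) ^+ 2.
have -> : overlap U i g = 1 - (\sum_y d y) / 2.
  have -> : \sum_y d y = 2 - 2 * overlap U i g.
    have -> : (2 : R) = \sum_y (@mass R I U i y + mass g y).
      by rewrite big_split /= !U1.
    rewrite big_split /= !U1 -[1 + 1]/(2%:R) /overlap mulr_sumr.
    have -> : (2 : R) = \sum_y (@mass R I U i y + mass g y).
      by rewrite big_split /= !U1.
    rewrite -sumrB; apply: eq_bigr => y _; rewrite /d.
    have := sqr_sqrtr (ltW (@mass_gt0 R I U i y)).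
    have := sqr_sqrtr (ltW (@mass_gt0 R I U g y)).
    rewrite sqrtrM ?ltW ?mass_gt0 // big_split /= !U1.
    move: (Num.sqrt _) (Num.sqrt _) => s b <- <-; ring.
  by field.
suff : 0 < \sum_y d y by lra.
rewrite (bigD1 x) //= ltr_pwDl //; last by apply: sumr_ge0 => y _; exact: sqr_ge0.
rewrite lt_def sqr_ge0 andbT sqrf_eq0 subr_eq0; apply/eqP => E; apply: xd.
rewrite -[LHS]sqr_sqrtr ?ltW ?mass_gt0 // E sqr_sqrtr // ltW // mass_gt0 //.
Qed.

(* The guess is by maximum likelihood, so the overlaps bound its error. *)
Lemma guess_noise U (i0 : I) : is_probability U ->
  (forall i g, i != g -> exists x, @mass R I U i x <> mass g x) ->
  exists2 c : R, 0 < c & forall N, exists gam : carrier (tensor_exp U N) -> I,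
    forall g i, g != i -> \sum_(z | gam z == g) mass i z <= expR (- (N%:R * c)).
Proof.
move=> U1 Ud.
(* The default 1/2 keeps [rho] strictly between 0 and 1 even if there is only one hypothesis. *)
pose rho := \big[Num.max/(1 / 2)]_(ig : I * I | ig.1 != ig.2) overlap U ig.1 ig.2.
have rho1 : rho < 1.
  by apply: bigmax_lt => [|[i g] /= ig]; [lra|exact/overlap_lt1/Ud].
have rho0 : 0 < rho by apply: lt_le_trans (bigmax_ge_id _ _ _ _); lra.
exists (- ln rho); first by rewrite oppr_gt0 ln_lt0 // rho0.
move=> N; exists (fun z => [arg max_(i > i0) (mass i z)]%O) => g i gi.
rewrite mulrN opprK expRM_natl lnK ?posrE //.
apply: le_trans (_ : overlap U i g ^+ N <= _); last first.
  have o0 : 0 <= overlap U i g by apply: sumr_ge0 => x _; exact: sqrtr_ge0.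
  rewrite lerXn2r ?nnegrE ?(ltW rho0) //.
  by apply: (@le_bigmax_cond _ _ _ _ (i, g)) => /=; rewrite eq_sym.
rewrite -overlap_exp /overlap [leRHS](bigID (fun z => [arg max_(i > i0) (mass i z)]%O == g)) /=.
rewrite -[leLHS]addr0 lerD //; last by apply: sumr_ge0 => z _; exact: sqrtr_ge0.
apply: ler_sum => z /eqP.
case: arg_maxP => // g' _ gmax gE; rewrite gE in gmax.
have m0 h : 0 <= mass h z := ltW (mass_gt0 h z).
rewrite -[leLHS]ger0_norm // -sqrtr_sqr ler_wsqrtr // expr2 ler_wpM2l //.
exact: gmax.
Qed.
End Noise.

Section LargePowers.
Variables (R : realType) (I : finType) (A B U : mfamily R I).
Local Notation a := (@mass R I A).
Local Notation b := (@mass R I B).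

(** The parameters are chosen in dependency order: [c] from [U], then [kap] and [th] from [c], then
    [k] from all of them, and finally [N]. *)
Lemma large_powers (i0 : I) :
  is_probability A -> is_probability B -> is_probability U ->
  fnonzero A -> fnonzero B ->
  (forall i g, i != g -> exists x, @mass R I U i x <> mass g x) ->
  (forall alpha, (forall i, 0 <= alpha i <= 1) ->
    \sum_i alpha i = 1 -> logZ a alpha <= logZ b alpha) ->
  (forall alpha g, (forall i, i != g -> alpha i <= 0) ->
    \sum_i alpha i = 1 -> logZ b alpha <= logZ a alpha) ->
  exists N0, forall N, (N0 <= N)%N ->
    majorizes (tensor (tensor_exp U N) (tensor_exp A N)) (tensor_exp B N).
Proof.
move=> A1 B1 U1 /fnonzeroP A0 /fnonzeroP B0 Ud simplex cone.
have [c c0 noise] := guess_noise i0 U1 Ud.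
pose C := \sum_i \sum_x `|ln (a i x)| + \sum_i \sum_y `|ln (b i y)|.
have lnF (F : mfamily R I) i x :
    `|ln (@mass R I F i x)| <= \sum_i \sum_x `|ln (@mass R I F i x)|.
  rewrite (bigD1 i) //= (bigD1 x) //= -addrA lerDl addr_ge0 ?sumr_ge0 // => j _.
  exact: sumr_ge0.
have C0 : 0 <= C by rewrite addr_ge0 // sumr_ge0 // => j _; exact: sumr_ge0.
have lnA i x : `|ln (a i x)| <= C.
  apply: le_trans (lnF A i x) _; rewrite /C lerDl sumr_ge0 // => j _.
  exact: sumr_ge0.
have lnB i x : `|ln (b i x)| <= C.
  apply: le_trans (lnF B i x) _; rewrite /C lerDr sumr_ge0 // => j _.
  exact: sumr_ge0.
pose m := (#|carrier A| + #|carrier B|)%N.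
have m0 : 0 <= m%:R :> R by [].
have c16 : 0 < c / 16 by rewrite divr_gt0.
have [kap [/andP[kap0 _] kapc]] :=
  scale_small (mulr_ge0 m0 (mulr_ge0 (ler0n _ 2) C0)) c16.
have [th [/andP[th0 th1] thc]] := scale_small (mulr_ge0 (ler0n _ 4) C0) c16.
pose z := kap ^+ 2 / 4.
have z0 : 0 < z by rewrite divr_gt0 // exprn_gt0.
have thz : 0 < th * z / 2 by rewrite divr_gt0 // mulr_gt0.
have C3 : 0 <= 3 + C by rewrite addr_ge0.
have s0 : 0 < Num.min (th * z / 2) (c / 16) by rewrite lt_min thz.
have [k [/andP[k0 k1]]] := scale_small (mulr_ge0 m0 C3) s0.
rewrite le_min => /andP[kth kc].
(* The smallest of three decay rates: that of [eps], that of [K] times the guessing error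
   ([c - c / 4]), and that of the rounding error in [type_near]. The polynomial prefactors are all
   at most [10 * n ^+ 2], besides the factor [#|I|]. *)
pose e := Num.min (Num.min (th * z / 2) (c * (3 / 4))) ((k ^+ 2) ^+ 2 / 4).
have e0 : 0 < e.
  rewrite !lt_min thz /= mulr_gt0 //= ?divr_gt0 //; do 2 apply: exprn_gt0 => //.
have [e1 e2 e3] : [/\ e <= th * z / 2, e <= c * (3 / 4) & e <= (k ^+ 2) ^+ 2 / 4].
  by rewrite !ge_min !lexx !orbT.
have I0 : 0 <= #|I|%:R :> R by [].
have [|N0 N0P] := @poly_le_expR R (2 * m) e (10 * (10 * (10 * (#|I|%:R + 1)))) e0.
  by rewrite !mulr_ge0 ?ler0n // addr_ge0.
exists N0.+1 => N NN.
have Npos : (0 < N)%N by apply: leq_ltn_trans NN.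
have {N0P} := N0P _ (ltnW NN).
pose n : R := (N.+1 ^ m)%:R; pose E := expR (- (N%:R * e)).
rewrite mulnC expnM natrX -/n -/E => small.
have n1 : 1 <= n by rewrite ler1n expn_gt0.
have E0 : 0 <= E := expR_ge0 _.
have EF x : e <= x -> expR (- (N%:R * x)) <= E.
  by move=> ex; rewrite ler_expR lerN2 ler_wpM2l.
have nE0 : 0 <= n ^+ 2 * E by rewrite mulr_ge0 ?sqr_ge0.
have nE : n ^+ 2 * E <= 1 / 1000.
  have : 0 <= #|I|%:R * (n ^+ 2 * E) by rewrite mulr_ge0.
  lra.
have InE : #|I|%:R * (n ^+ 2 * E) <= 1 / 1000 by lra.
have nn : n <= n ^+ 2 by rewrite expr2 ler_peMl // (le_trans ler01).
have n0 : 0 <= n := le_trans ler01 n1.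
have [gam gamP] := noise N.
apply: majorizes_trans (types_majorizes_power B N).
apply: majorizes_trans (majorizes_tensor (majorizes_refl _)
  (power_majorizes_types A N)) _.
apply: (@types_routing R I A B A1 B1 A0 B0 simplex cone C c th k kap N Npos
  lnA lnB C0 c0 _ _ _ _ _ _ _ _ _ gam) => //.
- by rewrite (ltW th0).
- by rewrite (ltW k0).
- exact: ltW.
- by rewrite [k * _]mulrC [leLHS]mulrA.
- by rewrite [k * _]mulrC [leLHS]mulrA.
- by rewrite mulrAC.
- by rewrite [kap * _]mulrC [leLHS]mulrA.
- apply: le_trans (_ : n ^+ 2 * E <= _); last by lra.
  by apply: ler_pM => //; exact: EF.
- exact: tensor_exp_probability.
- apply: le_trans (_ : 2 * (n ^+ 2 * E) <= _); last by lra.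
  have := ler_wpM2l (sqr_ge0 n) (EF _ e1); rewrite -/n; lra.
- apply: le_trans (_ : 10 * (#|I|%:R * (n ^+ 2 * E)) <= _); last by lra.
  rewrite [leRHS]mulrCA ler_wpM2l // -/n.
  have -> : 2 * n * expR (N%:R * (c / 4)) * (n + 4) * expR (- (N%:R * c)) =
      2 * n * (n + 4) * expR (- (N%:R * (c * (3 / 4)))).
    have <- : expR (N%:R * (c / 4)) * expR (- (N%:R * c)) =
        expR (- (N%:R * (c * (3 / 4)))).
      by rewrite -expRD; congr expR; field.
    by ring.
  apply: le_trans (_ : 10 * n ^+ 2 * E <= _); last first.
    by rewrite [leRHS]mulrA.
  apply: ler_pM; [|exact: expR_ge0| |exact: EF].
    by rewrite !mulr_ge0 // addr_ge0.
  clear -n1; rewrite expr2; nra.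
Qed.
End LargePowers.

(** * Divergences as functionals *)

Section RenyiFunctional.
Variables (R : realType) (I : finType).
Implicit Types (P Q U : mfamily R I) (alpha : I -> R).

Lemma weighted_expR (w u : I -> R) : (forall i, 0 <= w i) -> \sum_i w i = 1 ->
  expR (\sum_i w i * u i) <= \sum_i w i * expR (u i).
Proof.
move=> w0 w1; set m := \sum_i _.
have -> : \sum_i w i * expR (u i) = expR m * \sum_i w i * expR (u i - m).
  rewrite mulr_sumr; apply: eq_bigr => i _.
  by rewrite mulrCA -expRD addrC subrK.
rewrite ler_peMr ?expR_ge0 //.
have <- : \sum_i w i * (1 + (u i - m)) = 1.
  under eq_bigr do rewrite mulrDr mulr1 mulrBr.
  by rewrite big_split /= sumrB w1 -mulr_suml w1 mul1r subrr addr0.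
by apply: ler_sum => i _; rewrite ler_wpM2l // expR_ge1Dx.
Qed.

(* AM-GM solved for the variable of index g, whose weight exceeds 1. *)
Lemma reverse_weighted_expR (al u : I -> R) g :
  (forall i, i != g -> al i <= 0) -> \sum_i al i = 1 ->
  \sum_i al i * expR (u i) <= expR (\sum_i al i * u i).
Proof.
move=> al0 al1; set m := \sum_i al i * u i.
have alg : 1 <= al g.
  rewrite -al1 (bigD1 g) //= gerDl; apply: sumr_le0 => i; exact: al0.
have ag0 : 0 < al g by apply: lt_le_trans alg.
pose w i := if i == g then (al g)^-1 else - al i / al g.
pose v i := if i == g then m else u i.
have sumE (F : I -> R) : \sum_i w i * F i =
    (F g - \sum_(i | i != g) al i * F i) / al g.
  rewrite (bigD1 g) //= /w eqxx mulrBl mulrC mulr_suml -sumrN; congr (_ + _).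
  by apply: eq_bigr => i /negbTE ->; rewrite !mulNr mulrAC.
have := @weighted_expR w v.
have w1 : \sum_i w i = 1.
  have -> : \sum_i w i = \sum_i w i * 1 by apply: eq_bigr => i _; rewrite mulr1.
  rewrite sumE.
  have -> : \sum_(i | i != g) al i * 1 = 1 - al g.
    rewrite -[in RHS]al1 [X in _ = X - _](bigD1 g) //= addrAC subrr add0r.
    by apply: eq_bigr => i _; rewrite mulr1.
  by rewrite opprB addrCA subrr addr0 divff // gt_eqF.
have w0 i : 0 <= w i.
  rewrite /w; case: eqP => [_|/eqP ig]; first by rewrite invr_ge0 ltW.
  by rewrite divr_ge0 ?oppr_ge0 ?al0 // ltW.
move=> /(_ w0 w1); rewrite !sumE /v eqxx.
have -> : m - \sum_(i | i != g) al i * (if i == g then m else u i) = al g * u g.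
  rewrite (eq_bigr (fun i => al i * u i)) => [|i /negbTE -> //].
  by rewrite /m (bigD1 g) //= addrK.
rewrite mulrAC divff ?gt_eqF // mul1r ler_pdivlMr //.
have -> : \sum_(i | i != g) al i * expR (if i == g then m else u i) =
    \sum_(i | i != g) al i * expR (u i).
  by apply: eq_bigr => i /negbTE ->.
by move=> h; rewrite (bigD1 g) //=; lra.
Qed.

Let energy_ratio P Q (alpha : I -> R) x y :
  expR (energy (@mass R I P) alpha x) = expR (energy (@mass R I Q) alpha y) *
  expR (\sum_i alpha i * (ln (mass i x) - ln (mass i y))).
Proof.
rewrite -expRD; congr expR; rewrite -big_split /=.
by apply: eq_bigr => i _; ring.
Qed.

Let weighted_ratio P Q (T : carrier Q -> carrier P -> R) alpha y :
  (forall i y, mass i y = \sum_x T y x * mass i x) -> \sum_i alpha i = 1 ->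
  \sum_x T y x * (\sum_i alpha i * expR (ln (mass i x) - ln (mass i y))) = 1.
Proof.
move=> TE a1.
under eq_bigr do rewrite mulr_sumr.
rewrite exchange_big /= -[RHS]a1; apply: eq_bigr => i _.
transitivity (alpha i * ((\sum_x T y x * mass i x) / mass i y)).
  rewrite mulr_suml mulr_sumr; apply: eq_bigr => x _.
  by rewrite expRD expRN !lnK ?posrE ?mass_gt0 //; ring.
by rewrite -TE divff ?mulr1 // gt_eqF // mass_gt0.
Qed.

Let sum_channel P Q (T : carrier Q -> carrier P -> R) (F : carrier P -> R) :
  column_stochastic T -> \sum_x F x = \sum_y \sum_x T y x * F x.
Proof.
move=> [_ T1]; rewrite exchange_big /=; apply: eq_bigr => x _.
by rewrite -mulr_suml T1 mul1r.
Qed.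

(** Data processing by AM-GM: the ratios of masses, averaged with [T y x] and [alpha], give exactly
    1 by [weighted_ratio], so the geometric means give at most 1. On the cone the reversed
    inequality plays the same part. *)
Lemma Z_simplex_mono P Q alpha : majorizes P Q -> (forall i, 0 <= alpha i) ->
  \sum_i alpha i = 1 -> \sum_x expR (energy (@mass R I P) alpha x) <=
    \sum_y expR (energy (@mass R I Q) alpha y).
Proof.
move=> [T [Tc TE]] a0 a1; rewrite (sum_channel _ Tc); apply: ler_sum => y _.
rewrite -[leRHS]mulr1 -[X in _ <= _ * X](weighted_ratio y TE a1) mulr_sumr.
apply: ler_sum => x _; rewrite (energy_ratio alpha x y) [leLHS]mulrCA.
by rewrite ler_wpM2l ?expR_ge0 // ler_wpM2l ?(Tc.1) // weighted_expR.
Qed.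

Lemma Z_cone_mono P Q alpha g : majorizes P Q ->
  (forall i, i != g -> alpha i <= 0) -> \sum_i alpha i = 1 ->
  \sum_y expR (energy (@mass R I Q) alpha y) <=
  \sum_x expR (energy (@mass R I P) alpha x).
Proof.
move=> [T [Tc TE]] a0 a1; rewrite [leRHS](sum_channel _ Tc); apply: ler_sum => y _.
rewrite -[leLHS]mulr1 -[X in _ * X <= _](weighted_ratio y TE a1) mulr_sumr.
apply: ler_sum => x _; rewrite (energy_ratio alpha x y) [leRHS]mulrCA.
rewrite ler_wpM2l ?expR_ge0 // ler_wpM2l ?(Tc.1) //.
exact: (reverse_weighted_expR _ a0 a1).
Qed.

Lemma logZ_tensor P Q alpha : (0 < #|carrier P|)%N -> (0 < #|carrier Q|)%N ->
  logZ (@mass R I (tensor P Q)) alpha =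
  logZ (@mass R I P) alpha + logZ (@mass R I Q) alpha.
Proof.
move=> P0 Q0; rewrite /logZ -lnM ?posrE ?Z_gt0 //; congr ln.
transitivity (\sum_x \sum_y expR (energy (@mass R I P) alpha x) *
    expR (energy (@mass R I Q) alpha y)); last first.
  by rewrite mulr_suml; apply: eq_bigr => x _; rewrite mulr_sumr.
rewrite pair_bigA; apply: eq_bigr => -[x y] _; rewrite -expRD /energy -big_split /=.
by congr expR; apply: eq_bigr => i _; rewrite lnM ?posrE ?mass_gt0 // mulrDr.
Qed.

Lemma renyiE P alpha : renyi alpha P =
  (\big[Num.max/0]_i alpha i - 1)^-1 * (logZ (@mass R I P) alpha / ln 2).
Proof.
rewrite /renyi /logZ; congr (_ * (ln _ / _)); apply: eq_bigr => x _.
rewrite /energy expR_sum; apply: eq_bigr => i _.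
by rewrite /powR gt_eqF // mass_gt0.
Qed.

Lemma probability_gt0 P (i : I) : is_probability P -> (0 < #|carrier P|)%N.
Proof.
move=> P1; rewrite lt0n; apply/eqP => P0; have := P1 i.
rewrite big1 => [/esym/eqP|x _]; first by rewrite oner_eq0.
by have := card0_eq P0 x; rewrite inE.
Qed.

Lemma admissible_inhabited alpha : admissible alpha -> inhabited I.
Proof.
move=> [a1 _]; apply: contrapT => nI; move: a1.
rewrite big1 => [/esym/eqP|i _]; first by rewrite oner_eq0.
by exfalso; apply: nI; exists.
Qed.

Let ln2_gt0 : 0 < ln 2 :> R. Proof. by rewrite ln_gt0 // ltr1n. Qed.

Lemma renyi_simplex_le P Q alpha : (forall i, 0 <= alpha i < 1) ->
  (renyi alpha Q <= renyi alpha P) =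
  (logZ (@mass R I P) alpha <= logZ (@mass R I Q) alpha).
Proof.
move=> a01; rewrite !renyiE ler_nM2l ?ler_pM2r ?invr_gt0 // invr_lt0 subr_lt0.
by apply: bigmax_lt => // i _; case/andP: (a01 i).
Qed.

Lemma renyi_cone_le P Q alpha g : 1 < alpha g ->
  (renyi alpha Q <= renyi alpha P) =
  (logZ (@mass R I Q) alpha <= logZ (@mass R I P) alpha).
Proof.
move=> ag; rewrite !renyiE ler_pM2l ?ler_pM2r ?invr_gt0 // subr_gt0.
exact: lt_le_trans ag (le_bigmax _ _ _).
Qed.

(** The two properties that pass to pointwise limits, so the divergences and their limits are
    treated together. They are confined to probability families because limits are controlled only
    there. *)
Definition monotone_additive (D : mfamily R I -> R) :=
  (forall P Q, is_probability P -> is_probability Q ->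
     D (tensor P Q) = D P + D Q) /\
  (forall P Q, is_probability P -> is_probability Q -> majorizes P Q ->
     D Q <= D P).

Lemma renyi_monotone_additive alpha :
  admissible alpha -> monotone_additive (renyi alpha).
Proof.
move=> adm; have [i0] := admissible_inhabited adm; case: adm => a1 adm.
split=> [P Q P1 Q1|P Q P1 Q1 PQ].
  rewrite !renyiE logZ_tensor ?(probability_gt0 i0) //; ring.
have P0 := probability_gt0 i0 P1; have Q0 := probability_gt0 i0 Q1.
case: adm => [a01|[g [ag a0]]].
  rewrite renyi_simplex_le // ler_ln ?posrE ?Z_gt0 //.
  by apply: Z_simplex_mono => // i; case/andP: (a01 i).
rewrite (renyi_cone_le _ _ ag) ler_ln ?posrE ?Z_gt0 //.
exact: Z_cone_mono PQ a0 a1.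
Qed.

Lemma renyi_limit_monotone_additive D : renyi_limit D -> monotone_additive D.
Proof.
move=> [alpha [adm Dlim]]; split=> [P Q P1 Q1|P Q P1 Q1 PQ].
  have PQ1 := tensor_probability P1 Q1.
  apply: (@cvg_unique _ _ ((fun k => renyi (alpha k) (tensor P Q)) @ \oo)) => //.
    exact: Dlim.
  rewrite (_ : (fun k => _) = (fun k => renyi (alpha k) P) \+
      (fun k => renyi (alpha k) Q)); first by apply: cvgD; exact: Dlim.
  by apply/funext => k; rewrite (renyi_monotone_additive (adm k)).1.
apply: ler_cvg_to (Dlim _ Q1) (Dlim _ P1) _.
by apply: nearW => k; exact: (renyi_monotone_additive (adm k)).2.
Qed.

(** Duality works with the closed simplex and cones, whereas admissible tuples omit the vertices.
    There both sides vanish by normalization. *)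
Lemma renyi_le_logZ A B (i0 : I) : is_probability A -> is_probability B ->
  (forall alpha, admissible alpha -> renyi alpha B <= renyi alpha A) ->
  (forall alpha, (forall i, 0 <= alpha i <= 1) -> \sum_i alpha i = 1 ->
     logZ (@mass R I A) alpha <= logZ (@mass R I B) alpha) /\
  (forall alpha g, (forall i, i != g -> alpha i <= 0) -> \sum_i alpha i = 1 ->
     logZ (@mass R I B) alpha <= logZ (@mass R I A) alpha).
Proof.
move=> A1 B1 AB.
have vertex F (alpha : I -> R) g : is_probability F ->
    (forall i, i != g -> alpha i = 0) -> \sum_i alpha i = 1 ->
    logZ (@mass R I F) alpha = 0.
  move=> F1 a0 a1.
  have -> : alpha = (fun i => (i == g)%:R).
    apply/funext => i; have [->|/a0 //] := eqVneq i g.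
    by rewrite -a1 (bigD1 g) //= big1 ?addr0.
  apply: logZ_vertex => [i|]; last exact: mass_gt0.
  by split=> [x|]; [exact: ltW (mass_gt0 _ _)|exact: F1].
split=> [alpha a01 a1|alpha g a0 a1].
  have [[g ag]|no1] := pselect (exists g, alpha g = 1).
    have a0 i : i != g -> alpha i = 0.
      move=> ig; apply/eqP; rewrite eq_le; case/andP: (a01 i) => -> _; rewrite andbT.
      move: a1; rewrite (bigD1 g) //= ag (bigD1 i) //= => E.
      suff : 0 <= \sum_(j | (j != g) && (j != i)) alpha j by lra.
      by apply: sumr_ge0 => j _; case/andP: (a01 j).
    by rewrite !(vertex _ _ g).
  have a01' i : 0 <= alpha i < 1.
    case/andP: (a01 i) => -> /=; rewrite le_eqVlt => /predU1P[ai|//].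
    by exfalso; apply: no1; exists i.
  rewrite -renyi_simplex_le //; apply: AB; split => //; by left.
have : 1 <= alpha g.
  rewrite -a1 (bigD1 g) //= gerDl; apply: sumr_le0 => i; exact: a0.
rewrite le_eqVlt => /predU1P[ag|ag]; last first.
  rewrite -(renyi_cone_le _ _ ag); apply: AB; split => //; right.
  by exists g.
have a0' i : i != g -> alpha i = 0.
  move=> ig; apply/eqP; rewrite eq_le a0 //=.
  move: a1; rewrite (bigD1 g) //= -ag (bigD1 i) //= => E.
  suff : \sum_(j | (j != g) && (j != i)) alpha j <= 0 by lra.
  by apply: sumr_le0 => j /andP[jg _]; exact: a0.
by rewrite !(vertex _ _ g).
Qed.
End RenyiFunctional.

(** * Rates *)

Lemma eventually_small {R : realType} (C e : R) : 0 < e ->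
  exists N, forall n, (N <= n)%N -> (0 < n)%N /\ C / n%:R <= e.
Proof.
move=> e0; exists (Num.Def.archi_bound (`|C| / e)).+1 => n Nn.
have n0 : (0 < n)%N by apply: leq_trans Nn.
split => //; rewrite ler_pdivrMr ?ltr0n // -ler_pdivrMl // mulrC.
apply: le_trans (_ : `|C| / e <= _); first by rewrite ler_wpM2r ?invr_ge0 ?(ltW e0) // ler_norm.
have h : 0 <= `|C| / e by rewrite divr_ge0 // ltW.
by apply: le_trans (ltW (archi_boundP h)) _; rewrite ler_nat ltnW.
Qed.

Lemma sublinear_small {R : realType} (k : nat -> nat) (e : R) :
  sublinear R k -> 0 < e ->
  exists N, forall n, (N <= n)%N -> (0 < n)%N -> (k n)%:R <= e * n%:R.
Proof.
move=> /cvgr0Pnorm_lt kl e0; have [N _ NP] := kl _ e0.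
exists N => n Nn n0; have := NP n Nn; rewrite /= ger0_norm; last by rewrite divr_ge0.
by rewrite ltr_pdivrMr ?ltr0n // => /ltW.
Qed.

(** * A two-sided Fekete lemma *)

Section QuasiAdditive.
Variables (R : realType) (a : nat -> R) (k : nat -> nat) (u : R).
Hypothesis u_ge0 : 0 <= u.
Hypothesis k_sub : sublinear R k.
Hypothesis quasi : forall t (n : 'I_t -> nat), (0 < t)%N ->
  `|a (\sum_j n j)%N - \sum_j a (n j)| <= (\sum_j k (n j))%:R * u.

Let quasi_divn q m s :
  `|a (s + q * m)%N - (a s + q%:R * a m)| <= (k s + q * k m)%:R * u.
Proof.
have := @quasi q.+1 (fun j => if j == ord0 then s else m) isT.
rewrite !big_ord_recl /=.
rewrite !sum_nat_const !card_ord sumr_const card_ord -[a m *+ q]mulr_natl.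
done.
Qed.

Let err m := \sum_(s < m) ((k s)%:R * u + `|a s|) + `|a m|.

Let slope_near m n : (0 < m)%N -> (0 < n)%N ->
  `|n%:R^-1 * a n - m%:R^-1 * a m| <= (k m)%:R * u / m%:R + err m / n%:R.
Proof.
move=> m0 n0; have mR : 0 < m%:R :> R by rewrite ltr0n.
have nR : 0 < n%:R :> R by rewrite ltr0n.
rewrite -(ler_pM2r nR) mulrDl divfK ?gt_eqF //.
have <- (x : R) : `|x * n%:R| = `|x| * n%:R by rewrite normrM (gtr0_norm nR).
have -> : (n%:R^-1 * a n - m%:R^-1 * a m) * n%:R = a n - n%:R / m%:R * a m.
  by field; rewrite !gt_eqF.
pose q := (n %/ m)%N; pose s := (n %% m)%N.
have nE : n = (s + q * m)%N by rewrite addnC -divn_eq.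
have sm : (s < m)%N by rewrite ltn_mod.
have nq : n%:R / m%:R = q%:R + s%:R / m%:R :> R.
  by rewrite {1}nE natrD natrM; field; rewrite gt_eqF.
have sm1 : 0 <= (s%:R / m%:R : R) <= 1.
  by rewrite divr_ge0 //= ler_pdivrMr // mul1r ler_nat ltnW.
have -> : a n - n%:R / m%:R * a m =
    (a (s + q * m)%N - (a s + q%:R * a m)) + a s - s%:R / m%:R * a m.
  by rewrite -nE nq; ring.
apply: le_trans (ler_normB _ _) _.
have h1 : `|s%:R / m%:R * a m| <= `|a m|.
  by rewrite normrM ger0_norm; [rewrite ler_piMl //; case/andP: sm1|case/andP: sm1].
have h2 : (k s)%:R * u + `|a s| <= \sum_(s < m) ((k s)%:R * u + `|a s|).
  rewrite (bigD1 (Ordinal sm)) //= lerDl; apply: sumr_ge0 => j _.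
  by rewrite addr_ge0 // mulr_ge0.
have h3 := ler_normD (a (s + q * m)%N - (a s + q%:R * a m)) (a s).
have h4 := quasi_divn q m s.
have h5 : (k s + q * k m)%:R * u <= (k s)%:R * u + (k m)%:R * u / m%:R * n%:R.
  rewrite natrD natrM mulrDl lerD2l.
  have -> : (k m)%:R * u / m%:R * n%:R = (k m)%:R * u * (n%:R / m%:R).
    by rewrite -!mulrA [_^-1 * _]mulrC.
  have km0 : 0 <= (k m)%:R * u by rewrite mulr_ge0.
  rewrite nq -mulrA [leLHS]mulrC ler_wpM2l // lerDl.
  by case/andP: sm1.
rewrite /err; lra.
Qed.

(** Writing n = s + q m compares the slopes at [n] and [m] with an error [k m * u / m] plus a
    remainder of order 1/n. Sublinearity makes the slopes Cauchy; letting n tend to infinity with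
    [m] fixed removes the remainder. *)
Lemma quasi_additive_rate : exists r : R,
  (fun n => n%:R^-1 * a n) @ \oo --> r /\
  forall m, (0 < m)%N -> `|a m - m%:R * r| <= (k m)%:R * u.
Proof.
have cc : cauchy ((fun n => n%:R^-1 * a n) @ \oo).
  apply/cauchyP => e e0.
  have e2 : 0 < e / 4 / (u + 1) by rewrite !divr_gt0 // ltr_wpDl.
  have [N NP] := sublinear_small k_sub e2.
  have kN := NP N.+1 (leqnSn N) isT.
  exists (N.+1%:R^-1 * a N.+1).
  have e4 : 0 < e / 4 by rewrite divr_gt0.
  have [M MP] := eventually_small (err N.+1) e4.
  exists M => // n Mn /=.
  have [n0 hn] := MP n Mn; rewrite -ball_normE /= distrC.
  apply: le_lt_trans (slope_near _ n0) _ => //.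
  have : (k N.+1)%:R * u / N.+1%:R <= e / 4.
    rewrite ler_pdivrMr ?ltr0n //.
    have u1 : 0 < u + 1 by rewrite ltr_wpDl.
    apply: le_trans (_ : (k N.+1)%:R * (u + 1) <= _).
      by rewrite ler_wpM2l // lerDl.
    by rewrite -ler_pdivlMr // mulrAC.
  move=> h; apply: le_lt_trans (lerD h hn) _; lra.
have [r rP] : exists r : R, (fun n => n%:R^-1 * a n) @ \oo --> r.
  by exists (limn (fun n => n%:R^-1 * a n)); apply: R_complete.
exists r; split => // m m0.
have mR : 0 < m%:R :> R by rewrite ltr0n.
have h : `|r - m%:R^-1 * a m| <= (k m)%:R * u / m%:R.
  apply/ler_addgt0Pr => e e0; have e2 : 0 < e / 2 by rewrite divr_gt0.
  have /cvgrPdist_le/(_ _ e2) [M _ MP] := rP.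
  have [L LP] := eventually_small (err m) e2.
  have [n0 hn] := LP (M + L)%N (leq_addl _ _).
  have := MP (M + L)%N (leq_addr _ _); rewrite /=.
  have := slope_near m0 n0.
  have := ler_normD (r - (M + L)%:R^-1 * a (M + L)%N)
    ((M + L)%:R^-1 * a (M + L)%N - m%:R^-1 * a m).
  rewrite addrA subrK; lra.
have -> : a m - m%:R * r = - (m%:R * (r - m%:R^-1 * a m)).
  by field; rewrite gt_eqF.
by rewrite normrN normrM (gtr0_norm mR) mulrC -ler_pdivlMr.
Qed.
End QuasiAdditive.

Section Rates.
Variables (R : realType) (I : finType) (U : mfamily R I).
Implicit Types (P Q : mfamily R I) (F : nat -> mfamily R I).

Definition approximates k F := forall (t : nat) (n : 'I_t -> nat), (0 < t)%N ->
  majorizes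
    (tensor (tensor_exp U (\sum_(j < t) k (n j))%N) (F (\sum_(j < t) n j)%N))
    (\big[@tensor R I/fone R I]_(j < t) F (n j)) /\
  majorizes
    (tensor (tensor_exp U (\sum_(j < t) k (n j))%N)
       (\big[@tensor R I/fone R I]_(j < t) F (n j)))
    (F (\sum_(j < t) n j)%N).

Lemma big_tensor_probability t F (n : 'I_t -> nat) :
  (forall n, is_probability (F n)) ->
  is_probability (\big[@tensor R I/fone R I]_(j < t) F (n j)).
Proof.
move=> F1; elim: t n => [|t IH] n; first by rewrite big_ord0; exact: fone_probability.
by rewrite big_ord_recl; apply: tensor_probability.
Qed.

Section Functional.
Variable D : mfamily R I -> R.
Hypothesis D_ma : monotone_additive D.
Hypothesis U1 : is_probability U.

(** Invariance under [fequiv] is not part of [monotone_additive]; monotonicity in both directions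
    supplies it. *)
Lemma functional_fone : D (fone R I) = 0.
Proof.
have f1 := @fone_probability R I; have [Da Dm] := D_ma.
have := Da _ _ f1 f1.
have : D (tensor (fone R I) (fone R I)) = D (fone R I).
  have ff := tensor_probability f1 f1.
  apply/eqP; rewrite eq_le; apply/andP; split; apply: Dm => //.
    exact: fequiv_majorizes (fequiv_sym (tensor1 _)).
  exact: fequiv_majorizes (tensor1 _).
lra.
Qed.

Lemma functional_ge0 P : is_probability P -> 0 <= D P.
Proof.
move=> P1; rewrite -functional_fone; apply: D_ma.2 => //.
  exact: fone_probability.
exact/majorizes_fone.
Qed.

Lemma functional_exp (k : nat) : D (tensor_exp U k) = k%:R * D U.
Proof.
elim: k => [|k IH]; first by rewrite functional_fone mul0r.
rewrite /= D_ma.1 //; last exact: tensor_exp_probability.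
by rewrite IH -natr1 mulrDl mul1r addrC.
Qed.

Lemma functional_big t F (n : 'I_t -> nat) : (forall n, is_probability (F n)) ->
  D (\big[@tensor R I/fone R I]_(j < t) F (n j)) = \sum_(j < t) D (F (n j)).
Proof.
move=> F1; elim: t n => [|t IH] n; first by rewrite !big_ord0 functional_fone.
by rewrite !big_ord_recl D_ma.1 ?IH //; exact: big_tensor_probability.
Qed.

Lemma functional_rate k F : sublinear R k -> approximates k F ->
  (forall n, is_probability (F n)) ->
  exists r : R, rate_seq D F @ \oo --> r /\
    forall m, (0 < m)%N -> `|D (F m) - m%:R * r| <= (k m)%:R * D U.
Proof.
move=> ks Fk F1.
apply: (@quasi_additive_rate R (fun n => D (F n)) k (D U)) => //.
  exact: functional_ge0.
move=> t n t0; have [h1 h2] := Fk t n t0.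
have e1 := tensor_exp_probability (\sum_(j < t) k (n j))%N U1.
have b1 := big_tensor_probability n F1.
have := D_ma.2 _ _ (tensor_probability e1 (F1 _)) b1 h1.
have := D_ma.2 _ _ (tensor_probability e1 b1) (F1 _) h2.
rewrite !D_ma.1 // functional_exp functional_big // ler_norml; lra.
Qed.
End Functional.

Lemma approximates_power k F m N s : approximates k F ->
  majorizes (tensor (tensor_exp U (k s + N * k m)) (F (s + N * m)%N))
    (tensor (F s) (tensor_exp (F m) N)) /\
  majorizes (tensor (tensor_exp U (k s + N * k m))
    (tensor (F s) (tensor_exp (F m) N))) (F (s + N * m)%N).
Proof.
move=> Fk; have := Fk N.+1 (fun j => if j == ord0 then s else m) isT.
by rewrite !big_ord_recl /= !sum_nat_const !card_ord big_const_ord.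
Qed.

Hypothesis hU : power_universal U.

Lemma universal_probability : is_probability U.
Proof. by case: hU => _ U1 _; apply/majorizes_fone. Qed.

Lemma universal_dominates P : is_probability P -> fnonzero P ->
  exists k, majorizes (tensor_exp U k) P.
Proof.
move=> P1 P0; case: hU => _ _ /(_ _ _ (@fone_nonzero R I) P0) [].
  exact/majorizes_fone.
move=> k h; exists k; apply: majorizes_trans h.
exact: fequiv_majorizes (fequiv_sym (tensor1 _)).
Qed.

(** If two columns of [U] agreed, they would agree in all powers and in everything these majorize,
    including a two-point family built to separate [i] from [g]. *)
Lemma universal_distinct (i g : I) : i != g ->
  exists x, @mass R I U i x <> mass g x.
Proof.
move=> ig; apply: contrapT => same.
have {}same x : @mass R I U i x = mass g x.
  by apply: contrapT => h; apply: same; exists x.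
pose q (h : I) (b : bool) : R := if (h == i) == b then 2 / 3 else 1 / 3.
have q0 h b : 0 < q h b by rewrite /q; case: eqP => _; lra.
pose Q := @MFamily R I bool q q0.
have Q1 : is_probability Q.
  by move=> h; rewrite big_bool /= /q; case: (h == i) => /=; lra.
have Q0 : fnonzero Q by apply/fnonzeroP; rewrite card_bool.
have [k [T [_ TE]]] := universal_dominates Q1 Q0.
have eqk z : @mass R I (tensor_exp U k) i z = mass g z.
  by elim: k z {T TE} => [//|k IH] [x z] /=; rewrite same IH.
have : @mass R I Q i true = @mass R I Q g true.
  by rewrite !TE; apply: eq_bigr => z _; rewrite eqk.
rewrite /= /q !eqxx (eq_sym g i) (negbTE ig) /=; lra.
Qed.

Section Catalytic.
Variables (P Q : nat -> mfamily R I) (kP kQ : nat -> nat).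
Hypothesis P1 : forall n, is_probability (P n).
Hypothesis Q1 : forall n, is_probability (Q n).
Hypothesis Q0 : forall n, fnonzero (Q n).
Hypothesis P_k : approximates kP P.
Hypothesis Q_k : approximates kQ Q.

(** The exponents pay, in order, for reassembling [Q] from blocks, creating [Q s] from [U] alone,
    comparing the blocks, and cutting [P] into blocks; [P s] is discarded. *)
Lemma catalyst_compose m N s x y :
  majorizes (tensor_exp U x) (Q s) ->
  majorizes (tensor (tensor_exp U y) (tensor_exp (P m) N)) (tensor_exp (Q m) N) ->
  majorizes (tensor (tensor_exp U
    ((kQ s + N * kQ m) + (x + (y + (kP s + N * kP m))))) (P (s + N * m)%N))
    (Q (s + N * m)%N).
Proof.
move=> Ux Uy; have [hP _] := approximates_power m N s P_k.
have [_ hQ] := approximates_power m N s Q_k.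
set v := (kP s + _)%N in hP *; set w := (kQ s + _)%N in hQ *.
apply: majorizes_trans hQ.
have E i j (S : mfamily R I) : fequiv (tensor (tensor_exp U (i + j)) S)
    (tensor (tensor_exp U i) (tensor (tensor_exp U j) S)).
  apply: fequiv_trans (tensor_assoc _ _ _).
  exact: fequiv_tensor (tensor_expD _ _ _) (fequiv_refl _).
apply: majorizes_trans (fequiv_majorizes (E _ _ _)) _.
apply: majorizes_tensor (majorizes_refl _) _.
apply: majorizes_trans (fequiv_majorizes (E _ _ _)) _.
apply: majorizes_tensor Ux _.
apply: majorizes_trans (fequiv_majorizes (E _ _ _)) _.
apply: majorizes_trans Uy; apply: majorizes_tensor (majorizes_refl _) _.
apply: majorizes_trans hP _; apply: majorizes_trans (fequiv_majorizes (tensor1l _)).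
apply: majorizes_tensor (majorizes_refl _).
exact/majorizes_fone/P1.
Qed.

Lemma catalyst_exists n : exists c, majorizes (tensor (tensor_exp U c) (P n)) (Q n).
Proof.
have [c Uc] := universal_dominates (Q1 n) (@Q0 n); exists c.
apply: majorizes_trans (fequiv_majorizes (tensor1 _)).
by apply: majorizes_tensor Uc _; exact/majorizes_fone/P1.
Qed.

(** Each block costs 1 for [large_powers], [kP m + kQ m] to secure the divergence inequalities, and
    as much again for cutting and reassembling. The remainders [s < m] contribute a bounded
    amount. *)
Lemma catalyst_bound (i0 : I) m : (0 < m)%N ->
  (forall alpha, admissible alpha ->
     renyi alpha (Q m) <= renyi alpha (tensor (tensor_exp U (kP m + kQ m)) (P m))) ->
  exists M C, forall n, (M <= n)%N -> exists c,
    majorizes (tensor (tensor_exp U c) (P n)) (Q n) /\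
    (c <= C + n %/ m * (1 + 2 * (kP m + kQ m)))%N.
Proof.
move=> m0 PQ; pose A := tensor (tensor_exp U (kP m + kQ m)) (P m).
have U1 := universal_probability.
have A1 : is_probability A by apply: tensor_probability (P1 m); exact: tensor_exp_probability.
have A0 : fnonzero A by apply/fnonzeroP/(probability_gt0 i0).
have [simplex cone] := renyi_le_logZ i0 A1 (Q1 m) PQ.
have [N0 N0P] := large_powers i0 A1 (Q1 m) U1 A0 (@Q0 m) universal_distinct
  simplex cone.
have [x xP] := choice (fun s => universal_dominates (Q1 s) (@Q0 s)).
exists (N0 * m)%N, (\sum_(s < m) (x s + kP s + kQ s))%N => n nM.
pose N := (n %/ m)%N; pose s := (n %% m)%N.
have nE : n = (s + N * m)%N by rewrite addnC -divn_eq.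
have NN : (N0 <= N)%N by rewrite leq_divRL.
have sm : (s < m)%N by rewrite ltn_mod.
have Uy : majorizes (tensor (tensor_exp U (N + N * (kP m + kQ m)))
    (tensor_exp (P m) N)) (tensor_exp (Q m) N).
  apply: majorizes_trans (N0P _ NN); apply: fequiv_majorizes.
  apply: fequiv_trans (fequiv_tensor (tensor_expD _ _ _) (fequiv_refl _)) _.
  apply: fequiv_trans (tensor_assoc _ _ _) _.
  apply: fequiv_tensor (fequiv_refl _) _; apply: fequiv_sym.
  apply: fequiv_trans (tensor_exp_tensor _ _ _) _.
  exact: fequiv_tensor (tensor_expM _ _ _) (fequiv_refl _).
exists (kQ s + N * kQ m + (x s + (N + N * (kP m + kQ m) + (kP s + N * kP m))))%N.
split; first by rewrite {1 2}nE; exact: catalyst_compose.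
have : (x s + kP s + kQ s <= \sum_(s < m) (x s + kP s + kQ s))%N.
  by rewrite (bigD1 (Ordinal sm)) //= leq_addr.
rewrite -/N; nia.
Qed.
End Catalytic.
End Rates.

(** * Rates and catalytic majorization *)

Section Equivalence.
Variables (R : realType) (I : finType) (U : mfamily R I).
Variables (P Q : nat -> mfamily R I) (kP kQ : nat -> nat).
Hypothesis hU : power_universal U.
Hypothesis P1 : forall n, is_probability (P n).
Hypothesis Q1 : forall n, is_probability (Q n).
Hypothesis Q0 : forall n, fnonzero (Q n).
Hypothesis kP_sub : sublinear R kP.
Hypothesis kQ_sub : sublinear R kQ.
Hypothesis P_k : approximates U kP P.
Hypothesis Q_k : approximates U kQ Q.

Let U1 : is_probability U := universal_probability hU.

Lemma catalysis_rate D (k : nat -> nat) : monotone_additive D -> sublinear R k ->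
  (forall n, majorizes (tensor (tensor_exp U (k n)) (P n)) (Q n)) ->
  rate D Q <= rate D P.
Proof.
move=> ma ks kPQ.
have [rP [hP _]] := functional_rate ma U1 kP_sub P_k P1.
have [rQ [hQ _]] := functional_rate ma U1 kQ_sub Q_k Q1.
rewrite /rate (cvg_lim (@Rhausdorff R) hP) (cvg_lim (@Rhausdorff R) hQ).
have lim : (fun n => (k n)%:R / n%:R * D U + rate_seq D P n) @ \oo --> rP.
  rewrite -[rP]add0r -[0](mul0r (D U)).
  by apply: cvgD hP; apply: cvgMl.
apply: ler_cvg_to hQ lim _; apply: nearW => n.
have e1 := tensor_exp_probability (k n) U1.
have := ma.2 _ _ (tensor_probability e1 (P1 n)) (Q1 n) (kPQ n).
rewrite ma.1 // functional_exp // => h.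
have n0 : 0 <= n%:R^-1 :> R by rewrite invr_ge0.
have := ler_wpM2l n0 h; rewrite /rate_seq mulrDr mulrA [_^-1 * _]mulrC; lra.
Qed.

(** The deviations of [P m] and [Q m] from their rates are at most [kP m] and [kQ m] times the
    divergence of [U], exactly what the added power of [U] provides, whatever [alpha] is. *)
Lemma rates_renyi_le (alpha : I -> R) (m : nat) : (0 < m)%N -> admissible alpha ->
  rate (renyi alpha) Q <= rate (renyi alpha) P ->
  renyi alpha (Q m) <= renyi alpha (tensor (tensor_exp U (kP m + kQ m)) (P m)).
Proof.
move=> m0 adm; have ma := renyi_monotone_additive adm.
have [rP [hP bP]] := functional_rate ma U1 kP_sub P_k P1.
have [rQ [hQ bQ]] := functional_rate ma U1 kQ_sub Q_k Q1.
rewrite /rate (cvg_lim (@Rhausdorff R) hP) (cvg_lim (@Rhausdorff R) hQ) => rr.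
rewrite ma.1 //; last exact: tensor_exp_probability.
rewrite functional_exp // natrD.
have := bP m m0; have := bQ m m0; rewrite !ler_norml.
have : m%:R * rQ <= m%:R * rP by rewrite ler_wpM2l.
lra.
Qed.

Lemma rates_catalysis (i0 : I) :
  (forall alpha, admissible alpha ->
     rate (renyi alpha) Q <= rate (renyi alpha) P) ->
  exists k, sublinear R k /\
    forall n, majorizes (tensor (tensor_exp U (k n)) (P n)) (Q n).
Proof.
move=> rPQ.
have ex n : exists c, `[< majorizes (tensor (tensor_exp U c) (P n)) (Q n) >].
  by have [c hc] := catalyst_exists hU P1 Q1 Q0 n; exists c; apply/asboolP.
(* The block length [m] depends on [e], but one sequence must serve every [e]; the minimal exponent
   lies below all the bounds obtained. *)
exists (fun n => ex_minn (ex n)); split; last first.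
  by move=> n; case: ex_minnP => c /asboolP.
apply/cvgr0Pnorm_le => e e0.
have [e4 e16] : 0 < e / 4 /\ 0 < e / 16 by split; rewrite divr_gt0.
have [NP NPP] := sublinear_small kP_sub e16.
have [NQ NQP] := sublinear_small kQ_sub e16.
have [N1 N1P] := eventually_small 1 e4.
(* With this [m] a block costs at most [e / 2 * m], and the bounded part at most [e / 4 * n] for
   large [n]. *)
pose m := (NP + NQ + N1).+1.
have mP : (kP m)%:R <= e / 16 * m%:R by apply: NPP => //; rewrite /m; lia.
have mQ : (kQ m)%:R <= e / 16 * m%:R by apply: NQP => //; rewrite /m; lia.
have [m0 m1] : (0 < m)%N /\ 1 / m%:R <= e / 4 by apply: N1P; rewrite /m; lia.
have [M [C MP]] := catalyst_bound hU P1 Q1 Q0 P_k Q_k i0 m0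
  (fun alpha adm => rates_renyi_le m0 adm (rPQ alpha adm)).
have [L LP] := eventually_small C%:R e4.
exists (M + L)%N => // n /= nML.
have [n0 Cn] := LP n (leq_trans (leq_addl _ _) nML).
have [c [hc cle]] := MP n (leq_trans (leq_addr _ _) nML).
rewrite ger0_norm; last by rewrite divr_ge0.
have nR : 0 < n%:R :> R by rewrite ltr0n.
have mR : 0 < m%:R :> R by rewrite ltr0n.
rewrite ler_pdivrMr //.
apply: le_trans (_ : c%:R <= _).
  by rewrite ler_nat; case: ex_minnP => c' _; apply; exact/asboolP.
have {cle} : c%:R <= C%:R + (n %/ m)%:R * (1 + 2 * ((kP m)%:R + (kQ m)%:R)) :> R.
  by rewrite -natrD -natrM -[1 in leRHS]/(1%:R) -!natrD -natrM -natrD ler_nat.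
move: Cn m1; rewrite !ler_pdivrMr // => Cn m1.
have : (n %/ m)%:R * m%:R <= n%:R :> R by rewrite -natrM ler_nat leq_trunc_div.
have q0 : 0 <= (n %/ m)%:R :> R by [].
have : (n %/ m)%:R * (1 + 2 * ((kP m)%:R + (kQ m)%:R)) <=
    (n %/ m)%:R * (e / 2 * m%:R) by rewrite ler_wpM2l //; lra.
move: (n %/ m)%:R q0 => q q0 h1 h2.
have : q * m%:R * (e / 2) <= n%:R * (e / 2) by rewrite ler_wpM2r // divr_ge0 // ltW.
have : 0 <= e * n%:R by rewrite mulr_ge0 // ltW.
lra.
Qed.
End Equivalence.

Unset Implicit Arguments.
Set Strict Implicit.

Theorem proposition5p31 (R : realType) (I : finType)
    (P Q : nat -> mfamily R I) (U : mfamily R I)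
    (hU : power_universal U)
    (hP : approx_geometric U P) (hQ : approx_geometric U Q)
    (hP1 : forall n, is_probability (P n))
    (hQ1 : forall n, is_probability (Q n)) :
  (forall alpha : I -> R, admissible alpha ->
     cvgn (rate_seq (renyi alpha) P) /\ cvgn (rate_seq (renyi alpha) Q)) /\
  (forall D : mfamily R I -> R, renyi_limit D ->
     cvgn (rate_seq D P) /\ cvgn (rate_seq D Q)) /\
  ((exists k : nat -> nat, sublinear R k /\
      forall n, majorizes (tensor (tensor_exp U (k n)) (P n)) (Q n))
   <->
   ((forall alpha : I -> R, admissible alpha ->
       rate (renyi alpha) Q <= rate (renyi alpha) P) /\
    (forall D : mfamily R I -> R, renyi_limit D ->
       rate D Q <= rate D P))).
Proof.
have [Pnz [kP [kPs kPa]]] := hP; have [Qnz [kQ [kQs kQa]]] := hQ.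
have U1 := universal_probability hU.
have conv D (ma : monotone_additive D) :
    cvgn (rate_seq D P) /\ cvgn (rate_seq D Q).
  have [rP [cP _]] := functional_rate ma U1 kPs kPa hP1.
  have [rQ [cQ _]] := functional_rate ma U1 kQs kQa hQ1.
  by split; apply/cvg_ex; [exists rP|exists rQ].
split; first by move=> alpha adm; exact: conv (renyi_monotone_additive adm).
split; first by move=> D lim; exact: conv (renyi_limit_monotone_additive lim).
split=> [[k [ks kPQ]]|[rPQ _]].
  split=> [alpha adm|D lim].
    exact: (catalysis_rate hU hP1 hQ1 kPs kQs kPa kQa
      (renyi_monotone_additive adm) ks kPQ).
  exact: (catalysis_rate hU hP1 hQ1 kPs kQs kPa kQa
      (renyi_limit_monotone_additive lim) ks kPQ).
(* Guessing requires a hypothesis. For empty [I] majorization only asks for some column-stochastic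
   matrix, which exists because [Q n] has a row. *)
have [[i0]|nI] := pselect (inhabited I).
  exact: (rates_catalysis hU hP1 hQ1 Qnz kPs kQs kPa kQa i0).
exists (fun=> 0%N); split.
  rewrite /sublinear (_ : (fun n : nat => _) = (fun=> 0)); first exact: cvg_cst.
  by apply/funext => n; rewrite mul0r.
move=> n; have /fnonzeroP/card_gt0P[y0 _] := Qnz n.
exists (fun y _ => (y == y0)%:R); split; last by move=> i; case: nI; exists.
split=> [y x|x]; first exact: ler0n.
by rewrite (bigD1 y0) //= eqxx big1 ?addr0 // => y /negbTE ->.
Qed.
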